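(* Consider the attitude dynamics without disturbance $$J\dot\Omega+\Omega\times J\Omega=u,\qquad \dot R=R\hat\Omega,$$ with $R(t)\in\mathsf{SO(3)}$, $\Omega(t)\in\mathbb{R}^3$, control moment $u\in\mathbb{R}^3$ and inertia matrix $J\in\mathbb{R}^{3\times 3}$, whose minimum eigenvalue $\lambda_m$ and maximum eigenvalue $\lambda_M$ are known. Let $R_d(t)\in\mathsf{SO(3)}$ be a given smooth attitude command with $\dot R_d=R_d\hat\Omega_d$. For positive constants $k_R,k_\Omega,k_J\in\mathbb{R}$, define the control input and the update law for the estimate $\bar J\in\mathbb{R}^{3\times3}$ of $J$ by \begin{align*} u&=-k_Re_R-k_\Omega e_\Omega+\Omega\times\bar J\Omega+\bar J\alpha_d,\\ \dot{\bar J}&=\frac{k_J}{2}\left(-\alpha_de_A^T-e_A\alpha_d^T+\Omega\Omega^T\hat e_A-\hat e_A\Omega\Omega^T\right), \end{align*} where $e_A=e_\Omega+c\,e_R\in\mathbb{R}^3$ for a positive constant $c$ satisfying $$c<\min\left\{\sqrt{\frac{2b_1k_R\lambda_m}{\lambda_M^2}},\ \frac{\sqrt2\,k_\Omega}{\lambda_M\mathrm{tr}[G]},\ \frac{4k_Rk_\Omega}{k_\Omega^2+\frac{4}{\sqrt2}k_R\lambda_M\mathrm{tr}[G]}\right\}.$$ Then the zero equilibrium of the tracking errors $(e_R,e_\Omega)$ and the estimation error $\tilde J=J-\bar J$ is stable, and those errors are uniformly bounded. Furthermore, the tracking errors for the attitude and the angular velocity asymptotically converge to zero, i.e. $e_R,e_\Omega\to0$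 as $t\to\infty$.
   Context: $\mathsf{SO(3)}=\{R\in\mathbb{R}^{3\times3}\mid R^TR=I,\ \det R=1\}$. The hat map $\wedge:\mathbb{R}^3\to\mathfrak{so}(3)$ sends $x$ to the skew-symmetric matrix $\hat x$ with $\hat xy=x\times y$; the vee map $\vee$ is its inverse. $J$ is the constant symmetric positive definite inertia matrix of a rigid body; $J$, its estimate $\bar J$, and $\tilde J=J-\bar J$ are all symmetric. $G=\mathrm{diag}[g_1,g_2,g_3]$ with distinct positive constants $g_1,g_2,g_3$. The errors are $$e_R=\tfrac12\left(GR_d^TR-R^TR_dG\right)^\vee,\qquad e_\Omega=\Omega-R^TR_d\Omega_d,$$ and $\alpha_d=-\hat\Omega R^TR_d\Omega_d+R^TR_d\dot\Omega_d$, where $\Omega_d(t)\in\mathbb{R}^3$ is the desired angular velocity. The constant $b_1$ is $b_1=\frac{h_1}{h_2+h_3}$ with $h_1=\min\{g_1+g_2,g_2+g_3,g_3+g_1\}$, $h_2=\max\{(g_1-g_2)^2,(g_2-g_3)^2,(g_3-g_1)^2\}$, $h_3=\max\{(g_1+g_2)^2,(g_2+g_3)^2,(g_3+g_1)^2\}$. The zero equilibrium of the tracking errors, $(e_R,e_\Omega)=(0,0)$, $\tilde J=0$, refers to the desired equilibrium $R=R_d$, $\Omega=\Omega_d$, $\bar J=J$.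
   Formalization: The convergence of e_Ω to zero is asserted only when the desired angular velocity Ω_d and its time derivative are bounded for t ≥ 0; for an arbitrary smooth attitude command it can fail. *)

(* Defs.v *)
(* Scalars are an arbitrary K : realType. *)
From HB Require Import structures.
From mathcomp Require Import all_boot all_order all_algebra.
From mathcomp Require Import all_classical all_reals all_analysis.
Set Implicit Arguments.
Unset Strict Implicit.
Unset Printing Implicit Defensive.
Import Order.TTheory GRing.Theory Num.Theory.
Import numFieldNormedType.Exports.
Local Open Scope classical_set_scope.
Local Open Scope ring_scope.

(* Vectors of R^3 are columns.  The norm `|_| on vectors and matrices is the
   library's (entrywise maximum) norm; every use below (stability, boundedness,
   convergence) is insensitive to replacing it by an equivalent norm. *)

Definition col3 (K : realType) (a b c : K) : 'cV[K]_3 :=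
  \col_(i < 3) nth 0 [:: a; b; c] i.

Definition cross (K : realType) (x y : 'cV[K]_3) : 'cV[K]_3 :=
  col3 (x 1 0 * y 2 0 - x 2 0 * y 1 0)
       (x 2 0 * y 0 0 - x 0 0 * y 2 0)
       (x 0 0 * y 1 0 - x 1 0 * y 0 0).

Definition hat (K : realType) (x : 'cV[K]_3) : 'M[K]_3 :=
  \matrix_(i < 3, j < 3)
    nth 0 (nth [::] [:: [::       0; - x 2 0;   x 1 0];
                        [::   x 2 0;       0; - x 0 0];
                        [:: - x 1 0;   x 0 0;       0]] i) j.

(* Only meaningful on skew-symmetric matrices, where it inverts [hat]. *)
Definition vee (K : realType) (A : 'M[K]_3) : 'cV[K]_3 :=
  col3 (A 2 1) (A 0 2) (A 1 0).

Lemma hat_mul (K : realType) (x y : 'cV[K]_3) : hat x *m y = cross x y.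
Proof.
apply/colP => i; rewrite !mxE !big_ord_recl big_ord0 !mxE /=.
have e1 : lift ord0 ord0 = 1 :> 'I_3 by apply/val_inj.
have e2 : lift ord0 (lift ord0 ord0) = 2 :> 'I_3 by apply/val_inj.
rewrite e1 e2; case: i => [[|[|[|//]]] Hi] /=;
  by rewrite ?mul0r ?mulNr ?add0r ?addr0 // addrC.
Qed.

Lemma hatK (K : realType) : cancel (@hat K) (@vee K).
Proof.
by move=> x; apply/colP => -[[|[|[|//]]] Hi]; rewrite !mxE /=;
  congr (x _ _); apply/val_inj.
Qed.

Lemma veeK (K : realType) (A : 'M[K]_3) : A^T = - A -> hat (vee A) = A.
Proof.
move=> /matrixP skA.
have sk i j : A j i = - A i j by have := skA i j; rewrite !mxE.
have d0 i : A i i = 0.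
  by apply/eqP; rewrite -[_ == 0](mulrn_eq0 _ 2) mulr2n {1}sk addNr.
apply/matrixP => -[[|[|[|//]]] Hi] -[[|[|[|//]]] Hj]; rewrite !mxE /= -?sk;
  (try by apply/esym; rewrite -[RHS](d0 (Ordinal Hi)); congr (A _ _);
    apply/val_inj);
  by congr (A _ _); apply/val_inj.
Qed.

Definition SO3 (K : realType) (A : 'M[K]_3) : Prop :=
  A^T *m A = 1%:M /\ \det A = 1.

Definition posdef (K : realType) (A : 'M[K]_3) : Prop :=
  forall x : 'cV[K]_3, x != 0 -> 0 < (x^T *m A *m x) 0 0.

(* [eigenvalue] uses row eigenvectors; for the symmetric matrices considered
   here this is the same as column eigenvectors. *)
Definition is_min_eigenvalue (K : realType) (A : 'M[K]_3) (l : K) : Prop :=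
  eigenvalue A l /\ forall m : K, eigenvalue A m -> l <= m.

Definition is_max_eigenvalue (K : realType) (A : 'M[K]_3) (l : K) : Prop :=
  eigenvalue A l /\ forall m : K, eigenvalue A m -> m <= l.

Definition diag3 (K : realType) (g1 g2 g3 : K) : 'M[K]_3 :=
  diag_mx (col3 g1 g2 g3)^T.

Definition b1 (K : realType) (g1 g2 g3 : K) : K :=
  let h1 := Num.min (Num.min (g1 + g2) (g2 + g3)) (g3 + g1) in
  let h2 := Num.max (Num.max ((g1 - g2) ^+ 2) ((g2 - g3) ^+ 2))
                    ((g3 - g1) ^+ 2) in
  let h3 := Num.max (Num.max ((g1 + g2) ^+ 2) ((g2 + g3) ^+ 2))
                    ((g3 + g1) ^+ 2) in
  h1 / (h2 + h3).

Definition e_R (K : realType) (G R Rd : 'M[K]_3) : 'cV[K]_3 :=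
  2^-1 *: vee (G *m Rd^T *m R - R^T *m Rd *m G).

Definition e_Om (K : realType) (R Rd : 'M[K]_3) (Om Omd : 'cV[K]_3) :
    'cV[K]_3 :=
  Om - R^T *m Rd *m Omd.

Definition e_A (K : realType) (c : K) (G R Rd : 'M[K]_3) (Om Omd : 'cV[K]_3) :
    'cV[K]_3 :=
  e_Om R Rd Om Omd + c *: e_R G R Rd.

(* [dOmd] stands for the time derivative of the desired angular velocity. *)
Definition alpha_d (K : realType) (R Rd : 'M[K]_3) (Om Omd dOmd : 'cV[K]_3) :
    'cV[K]_3 :=
  - (hat Om *m R^T *m Rd *m Omd) + R^T *m Rd *m dOmd.

Definition control (K : realType) (kR kOm : K) (G R Rd : 'M[K]_3)
    (Om Omd dOmd : 'cV[K]_3) (Jbar : 'M[K]_3) : 'cV[K]_3 :=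
  - (kR *: e_R G R Rd) - kOm *: e_Om R Rd Om Omd
  + cross Om (Jbar *m Om) + Jbar *m alpha_d R Rd Om Omd dOmd.

Definition update_law (K : realType) (kJ c : K) (G R Rd : 'M[K]_3)
    (Om Omd dOmd : 'cV[K]_3) : 'M[K]_3 :=
  let eA := e_A c G R Rd Om Omd in
  let al := alpha_d R Rd Om Omd dOmd in
  (kJ / 2) *: (- (al *m eA^T) - eA *m al^T
               + Om *m Om^T *m hat eA - hat eA *m Om *m Om^T).

(* Infinitely differentiable curve. *)
Definition smooth_curve (K : realType) (m n : nat)
    (X : K -> 'M[K]_(m.+1, n.+1)) : Prop :=
  forall (k : nat) (t : K), derivable (derive1n k X) t 1.

Definition attitude_command (K : realType) (Rd : K -> 'M[K]_3)
    (Omd : K -> 'cV[K]_3) : Prop :=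
  [/\ forall t, SO3 (Rd t),
      smooth_curve Rd &
      forall t, derive1 Rd t = Rd t *m hat (Omd t)].

(* [t0, T), where T may be +oo *)
Definition time_span (K : realType) (t0 : K) (T : \bar K) : set K :=
  [set t | t0 <= t /\ (t%:E < T)%E].

(* (R, Om, Jbar) is a trajectory on [t0, T) of the rigid body in closed loop
   with the adaptive controller.  At the initial time only continuity is
   required, the differential equations being imposed on (t0, T). *)
Definition closed_loop (K : realType) (J : 'M[K]_3) (kR kOm kJ c : K)
    (G : 'M[K]_3) (Rd : K -> 'M[K]_3) (Omd : K -> 'cV[K]_3)
    (t0 : K) (T : \bar K)
    (R : K -> 'M[K]_3) (Om : K -> 'cV[K]_3) (Jbar : K -> 'M[K]_3) : Prop :=
  [/\ {within time_span t0 T, continuous R},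
      {within time_span t0 T, continuous Om},
      {within time_span t0 T, continuous Jbar},
      forall t, time_span t0 T t -> SO3 (R t) /\ (Jbar t)^T = Jbar t &
      forall t, t0 < t -> (t%:E < T)%E ->
        let u := control kR kOm G (R t) (Rd t) (Om t) (Omd t) (derive1 Omd t)
                   (Jbar t) in
        [/\ derivable R t 1, derivable Om t 1, derivable Jbar t 1 &
        [/\ J *m derive1 Om t + cross (Om t) (J *m Om t) = u,
            derive1 R t = R t *m hat (Om t) &
            derive1 Jbar t =
              update_law kJ c G (R t) (Rd t) (Om t) (Omd t) (derive1 Omd t)]]].

(* Lyapunov stability of R = Rd, Om = Omd, Jbar = J for the non-autonomous
   closed loop.  Closeness of the initial attitude is measured by R - Rd and not
   by e_R, because e_R also vanishes at attitudes other than Rd. *)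
Definition zero_errors_stable (K : realType) (J : 'M[K]_3) (kR kOm kJ c : K)
    (G : 'M[K]_3) (Rd : K -> 'M[K]_3) (Omd : K -> 'cV[K]_3) : Prop :=
  forall t0 eps : K, 0 < eps ->
  exists2 delta : K, 0 < delta &
  forall (T : \bar K) R Om Jbar,
    closed_loop J kR kOm kJ c G Rd Omd t0 T R Om Jbar ->
    `|R t0 - Rd t0| < delta ->
    `|e_Om (R t0) (Rd t0) (Om t0) (Omd t0)| < delta ->
    `|J - Jbar t0| < delta ->
    forall t, time_span t0 T t ->
      [/\ `|R t - Rd t| < eps,
          `|e_R G (R t) (Rd t)| < eps,
          `|e_Om (R t) (Rd t) (Om t) (Omd t)| < eps &
          `|J - Jbar t| < eps].

(* The bound is uniform in time, in the initial time and in the initial errors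
   of size at most a. *)
Definition errors_uniformly_bounded (K : realType) (J : 'M[K]_3)
    (kR kOm kJ c : K) (G : 'M[K]_3) (Rd : K -> 'M[K]_3) (Omd : K -> 'cV[K]_3) :
    Prop :=
  forall a : K, exists b : K,
  forall (t0 : K) (T : \bar K) R Om Jbar,
    closed_loop J kR kOm kJ c G Rd Omd t0 T R Om Jbar ->
    `|e_R G (R t0) (Rd t0)| <= a ->
    `|e_Om (R t0) (Rd t0) (Om t0) (Omd t0)| <= a ->
    `|J - Jbar t0| <= a ->
    forall t, time_span t0 T t ->
      [/\ `|e_R G (R t) (Rd t)| <= b,
          `|e_Om (R t) (Rd t) (Om t) (Omd t)| <= b &
          `|J - Jbar t| <= b].

Definition attitude_error_converges (K : realType) (J : 'M[K]_3)
    (kR kOm kJ c : K) (G : 'M[K]_3) (Rd : K -> 'M[K]_3) (Omd : K -> 'cV[K]_3) :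
    Prop :=
  forall (t0 : K) R Om Jbar,
    closed_loop J kR kOm kJ c G Rd Omd t0 +oo%E R Om Jbar ->
    e_R G (R t) (Rd t) @[t --> +oo] --> (0 : 'cV[K]_3).

Definition velocity_error_converges (K : realType) (J : 'M[K]_3)
    (kR kOm kJ c : K) (G : 'M[K]_3) (Rd : K -> 'M[K]_3) (Omd : K -> 'cV[K]_3) :
    Prop :=
  forall (t0 : K) R Om Jbar,
    closed_loop J kR kOm kJ c G Rd Omd t0 +oo%E R Om Jbar ->
    e_Om (R t) (Rd t) (Om t) (Omd t) @[t --> +oo] --> (0 : 'cV[K]_3).

(* Boundedness in forward time of the desired angular velocity and acceleration,
   on which convergence of e_Om relies.  With unbounded acceleration e_Om need
   not converge: for rotations about one principal axis, a command whose angular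
   acceleration consists of ever shorter pulses of fixed area makes
   (e_Om, J - Jbar) perform one full turn per pulse, so that e_Om has peaks that
   do not decay. *)
Definition bounded_command (K : realType) (Omd : K -> 'cV[K]_3) : Prop :=
  exists B : K, forall t, 0 <= t -> `|Omd t| <= B /\ `|derive1 Omd t| <= B.

(* Main.v *)
Require Import Defs.
From HB Require Import structures.
From mathcomp Require Import all_boot all_order all_algebra.
From mathcomp Require Import all_classical all_reals all_analysis.
From mathcomp Require Import ring lra.
Set Implicit Arguments.
Unset Strict Implicit.
Unset Printing Implicit Defensive.
Import Order.TTheory GRing.Theory Num.Theory.
Import numFieldNormedType.Exports.
Local Open Scope classical_set_scope.
Local Open Scope ring_scope.

(** The proof is Lyapunov's method followed by Barbalat's argument.

    Only the relative attitude [E = Rd^T R] matters: conjugating a hat matrix by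
    a rotation gives the hat matrix of the rotated vector ([hat_SO3_mul]), so
    [E' = E hat e] where [e] is the angular velocity error.  Put
    [Psi = 1/2 tr (G (1 - E))] and let [eR] be the attitude error; then
    [Psi' = eR . e] and [eR' = C e] for a matrix [C] with Frobenius norm at most
    [tr G / sqrt 2] ([attitude_rate_bound]).  With [P = J - Jbar] the closed loop
    reads [J e' = - kR eR - kOm e - Om x P Om - P alpha].

    The storage function is
      [V = 1/2 e . J e + c eR . J e + kR Psi + |P|^2 / (2 kJ)],
    written below after completing the square in [eA = e + c eR].  The update law
    is exactly the one for which every term of [V'] containing [P] cancels
    ([adaptation_work], [lyapunov_balance]).  What is left of [V'] is a quadratic
    form in [(e, eR)], negative definite by the third bound on [c]
    ([lyapunov_dissipation]).

    That [V] dominates the errors rests on [b1 |eR|^2 <= Psi] for every rotation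
    [E] ([navigation_ge]).  Combined with the first bound on [c], it makes [V] comparable from both sides
    to [|e|^2 + Psi + |P|^2] ([lyapunov_lower], [lyapunov_upper]).  Moreover [Psi]
    is comparable to [|1 - E|^2 = |R - Rd|^2], because [2 Psi] is the sum of the
    [g_i (1 - E_ii)], and [2 tr (1 - E) = |1 - E|^2].  As [V] does not increase,
    stability and uniform boundedness follow with one constant
    ([errors_le_initial]).

    Finally [V] decreases at a rate at least proportional to the square of each
    entry of [e] and [eR].  A nonnegative function cannot drop infinitely often
    by a fixed amount, so such an entry tends to zero as soon as its derivative
    is bounded ([barbalat]); no integral is involved.  For [eR] the derivative
    [C e] is always bounded; for [e] it is bounded when the command is.

    The eigenvalue bounds on [J] come from the fact that the supremum of the
    Rayleigh quotient is an eigenvalue ([rayleigh_le_eigenvalue]). *)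

(** * Matrices of order three, entry by entry *)

Lemma mul3E (K : realType) n p (A : 'M[K]_(n, 3)) (B : 'M[K]_(3, p)) i j :
  (A *m B) i j = A i 0 * B 0 j + A i 1 * B 1 j + A i 2 * B 2 j.
Proof.
rewrite mxE !big_ord_recl big_ord0 addr0 addrA.
by congr (_ + _ * _ + _ * _); congr (_ _ _); apply/val_inj.
Qed.

Lemma sum3E (K : realType) (F : 'I_3 -> K) : \sum_i F i = F 0 + F 1 + F 2.
Proof.
rewrite !big_ord_recl big_ord0 addr0 addrA.
by congr (_ + F _ + F _); apply/val_inj.
Qed.

Lemma tr3E (K : realType) (A : 'M[K]_3) : \tr A = A 0 0 + A 1 1 + A 2 2.
Proof. exact: sum3E. Qed.

Lemma ord3P (i : 'I_3) : [\/ i = 0, i = 1 | i = 2].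
Proof.
by case: i => -[|[|[|//]]] ?; [apply: Or31|apply: Or32|apply: Or33]; apply/val_inj.
Qed.

Lemma matrix3P (K : realType) (A B : 'M[K]_3) :
  [/\ A 0 0 = B 0 0, A 0 1 = B 0 1 & A 0 2 = B 0 2] ->
  [/\ A 1 0 = B 1 0, A 1 1 = B 1 1 & A 1 2 = B 1 2] ->
  [/\ A 2 0 = B 2 0, A 2 1 = B 2 1 & A 2 2 = B 2 2] -> A = B.
Proof.
move=> [a00 a01 a02] [a10 a11 a12] [a20 a21 a22].
by apply/matrixP => i j; case: (ord3P i) => ->; case: (ord3P j) => ->.
Qed.

Lemma det3E (K : realType) (A : 'M[K]_3) : \det A =
  A 0 0 * (A 1 1 * A 2 2 - A 1 2 * A 2 1)
  - A 0 1 * (A 1 0 * A 2 2 - A 1 2 * A 2 0)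
  + A 0 2 * (A 1 0 * A 2 1 - A 1 1 * A 2 0).
Proof.
(* reading entries through natural indices lets the lifted indices compute *)
pose f i j := A (inord i) (inord j).
have fE a b : A a b = f a b by rewrite /f !inord_val.
rewrite (expand_det_row _ 0) sum3E /cofactor.
rewrite !(expand_det_row _ 0) !big_ord_recl !big_ord0 /cofactor !det_mx11.
by rewrite !mxE !fE /= /bump /=; ring.
Qed.

(** The triple product of [A x], [A y], [A z] is [\det A] times that of
    [x], [y], [z]. *)
Lemma hat_conj (K : realType) (A : 'M[K]_3) (x : 'cV[K]_3) :
  A^T *m hat (A *m x) *m A = \det A *: hat x.
Proof.
apply: matrix3P; split; rewrite !mul3E !mxE /= ?sum3E ?mxE det3E. 
all: ring.
Qed.

(** * Frobenius inner product and Rayleigh quotients *)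

(** The Frobenius inner product; on columns it is the dot product, so one set of
    lemmas serves for vectors and for the inertia error. *)
Definition ip (K : realType) m n (A B : 'M[K]_(m, n)) : K := \tr (A^T *m B).

Section InnerProduct.
Context {K : realType} {m n : nat}.
Implicit Types A B C : 'M[K]_(m, n).

Lemma ipE A B : ip A B = \sum_i \sum_j A i j * B i j.
Proof.
rewrite exchange_big; apply: eq_bigr => j _; rewrite mxE.
by apply: eq_bigr => i _; rewrite mxE.
Qed.

Lemma ipC A B : ip A B = ip B A.
Proof. by rewrite /ip -mxtrace_tr trmx_mul trmxK. Qed.

Lemma ipDr A B C : ip A (B + C) = ip A B + ip A C.
Proof. by rewrite /ip mulmxDr mxtraceD. Qed.

Lemma ipDl A B C : ip (A + B) C = ip A C + ip B C.
Proof. by rewrite ipC ipDr !(ipC C). Qed.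

Lemma ipZr a A B : ip A (a *: B) = a * ip A B.
Proof. by rewrite /ip -scalemxAr mxtraceZ. Qed.

Lemma ipZl a A B : ip (a *: A) B = a * ip A B.
Proof. by rewrite ipC ipZr ipC. Qed.

Lemma ipNr A B : ip A (- B) = - ip A B.
Proof. by rewrite -scaleN1r ipZr mulN1r. Qed.

Lemma ipNl A B : ip (- A) B = - ip A B.
Proof. by rewrite ipC ipNr ipC. Qed.

Lemma ip_ge0 A : 0 <= ip A A.
Proof.
by rewrite ipE sumr_ge0 // => i _; rewrite sumr_ge0 // => j _; rewrite -expr2 sqr_ge0.
Qed.

Lemma sqr_entry_le_ip A i j : A i j ^+ 2 <= ip A A.
Proof.
rewrite ipE (bigD1 i) //= (bigD1 j) //= -expr2 -addrA lerDl addr_ge0 //.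
  by rewrite sumr_ge0 // => k _; rewrite -expr2 sqr_ge0.
by rewrite sumr_ge0 // => k _; rewrite sumr_ge0 // => l _; rewrite -expr2 sqr_ge0.
Qed.

Lemma ip_eq0 A : ip A A = 0 -> A = 0.
Proof.
move=> A0; apply/matrixP => i j; rewrite mxE; apply/eqP.
by rewrite -sqrf_eq0 eq_le sqr_ge0 andbT -A0 sqr_entry_le_ip.
Qed.

Lemma ip_gt0 A : A != 0 -> 0 < ip A A.
Proof.
by move=> A0; rewrite lt_neqAle ip_ge0 andbT eq_sym; apply: contraNneq A0 => /ip_eq0 ->.
Qed.

End InnerProduct.

Section InnerProductMul.
Context {K : realType}.

Lemma ip_mull m n p (A : 'M[K]_(m, n)) (B : 'M[K]_(n, p)) (C : 'M[K]_(m, p)) :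
  ip (A *m B) C = ip B (A^T *m C).
Proof. by rewrite /ip trmx_mul mulmxA. Qed.

Lemma discriminant_le (a b c : K) :
  0 <= c -> (forall t, 0 <= a + 2 * t * b + t ^+ 2 * c) -> b ^+ 2 <= a * c.
Proof.
rewrite le_eqVlt => /orP[/eqP <- {c} H|c0 H].
  have [->|b0] := eqVneq b 0; first by rewrite expr0n mulr0.
  (* the value of t at which the affine function equals -1 *)
  have := H (- (a + 1) / (2 * b)).
  rewrite mulr0 addr0 (_ : _ + _ = -1) ?oppr_ge0 ?ler10 //.
  by field.
have := H (- b / c).
rewrite (_ : _ + _ = (a * c - b ^+ 2) / c); last by field; rewrite gt_eqF.
by rewrite ler_pdivlMr // mul0r subr_ge0.
Qed.

Lemma ip_CS m n (A B : 'M[K]_(m, n)) : ip A B ^+ 2 <= ip A A * ip B B.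
Proof.
apply: discriminant_le (ip_ge0 B) _ => t; have := ip_ge0 (A + t *: B).
rewrite ipDl !ipDr !ipZl !ipZr (ipC B A); congr (0 <= _); ring.
Qed.

(** The form [x . A y] may be degenerate, hence the detour through the discriminant
    of its values along a line. *)
Lemma psd_CS n (A : 'M[K]_n) (x y : 'cV[K]_n) :
    A^T = A -> (forall z : 'cV[K]_n, 0 <= ip z (A *m z)) ->
  ip x (A *m y) ^+ 2 <= ip x (A *m x) * ip y (A *m y).
Proof.
move=> As Apos; apply: discriminant_le (Apos y) _ => t.
have := Apos (x + t *: y); rewrite mulmxDr -scalemxAr ipDl !ipDr !ipZl !ipZr.
rewrite [ip y (A *m x)]ipC ip_mull As; congr (0 <= _); ring.
Qed.

Lemma ip_colE n (x y : 'cV[K]_n) : ip x y = \sum_i x i 0 * y i 0.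
Proof. by rewrite ipE; apply: eq_bigr => i _; rewrite big_ord1. Qed.

Lemma ip_mulmx_le m n p (A : 'M[K]_(m, n)) (B : 'M[K]_(n, p)) :
  ip (A *m B) (A *m B) <= ip A A * ip B B.
Proof.
rewrite [ip A A]ipE [ip B B]ipE ipE mulr_suml ler_sum // => i _.
rewrite [X in _ * X]exchange_big mulr_sumr ler_sum // => j _.
have := ip_CS (row i A)^T (col j B); rewrite !ip_colE.
congr (_ ^+ 2 <= _ * _); last 2 first.
- by apply: eq_bigr => k _; rewrite !mxE.
- by apply: eq_bigr => k _; rewrite !mxE.
by rewrite mxE; apply: eq_bigr => k _; rewrite !mxE.
Qed.

Lemma normr_entry_le m n (A : 'M[K]_(m, n)) i j : `|A i j| <= `|A|.
Proof. by rewrite [leRHS]/Num.norm /= mx_normrE (le_bigmax _ _ (i, j)). Qed.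

Lemma mx_norm_leP m n (A : 'M[K]_(m, n)) a :
  0 <= a -> (forall i j, `|A i j| <= a) -> `|A| <= a.
Proof.
by move=> a0 H; rewrite [leLHS]/Num.norm /= mx_normrE (bigmax_le _ a0) // => -[].
Qed.

Lemma mx_norm_le_sqrt m n (A : 'M[K]_(m, n)) a : ip A A <= a -> `|A| <= Num.sqrt a.
Proof.
move=> Aa; apply: mx_norm_leP => [|i j]; first exact: sqrtr_ge0.
by rewrite -sqrtr_sqr ler_wsqrtr // (le_trans (sqr_entry_le_ip _ _ _)).
Qed.

Lemma ip_le_mx_norm m n (A : 'M[K]_(m, n)) : ip A A <= (m * n)%:R * `|A| ^+ 2.
Proof.
rewrite ipE (le_trans (y := \sum_(i < m) \sum_(j < n) `|A| ^+ 2)) //.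
  apply: ler_sum => i _; apply: ler_sum => j _; rewrite -expr2 -real_normK ?num_real //.
  by rewrite lerXn2r ?nnegrE // normr_entry_le.
by rewrite !sumr_const !card_ord -mulrnA mulnC mulr_natl.
Qed.

End InnerProductMul.

Section RayleighQuotient.
Context {K : realType} {n : nat}.
Implicit Types (A : 'M[K]_n) (x : 'cV[K]_n).

(** Cauchy-Schwarz for the form [A] at [x] and [y = A^-1 x] gives
    [|x|^4 <= (x . A x) (y . x)], and [y . x] is at most a multiple of [|x|^2]. *)
Lemma psd_unit_coercive A : A^T = A -> A \in unitmx ->
    (forall x, 0 <= ip x (A *m x)) ->
  exists2 b, 0 < b & forall x, b * ip x x <= ip x (A *m x).
Proof.
move=> As Au Apos.
pose C := ip (invmx A) (invmx A) + 1.
have C0 : 0 < C by rewrite ltr_wpDl // ip_ge0.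
exists C^-1; first by rewrite invr_gt0.
move=> x; rewrite ler_pdivrMl //.
have [->|x0] := eqVneq x 0; first by rewrite mulmx0 /ip mulmx0 mxtrace0 mulr0.
have x1 := ip_gt0 x0.
pose y := invmx A *m x; have Ay : A *m y = x by rewrite mulKVmx.
have H := psd_CS x y As Apos; rewrite Ay in H.
have yy : ip y y <= C * ip x x.
  rewrite (le_trans (ip_mulmx_le _ _)) // ler_wpM2r ?ip_ge0 //.
  by rewrite lerDl.
have yx0 : 0 <= ip y x by rewrite ipC -Ay ip_mull As Ay -Ay; apply: Apos.
have yx : ip y x <= C * ip x x.
  rewrite -(@ler_pXn2r _ 2) ?nnegrE ?mulr_ge0 ?(ltW x1) ?(ltW C0) //.
  rewrite (le_trans (ip_CS _ _)) // exprMn (expr2 (ip x x)) mulrA ler_pM2r //.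
  rewrite (le_trans yy) // ler_pM2r // expr2 ler_peMr ?(ltW C0) //.
  by rewrite lerDr ip_ge0.
rewrite -(ler_pM2r x1) -expr2 (le_trans H) // [leRHS]mulrAC mulrC.
by rewrite ler_wpM2r.
Qed.

(** Let [r] be the least upper bound of the Rayleigh quotient.  Then [r - A] is
    positive semidefinite; were it invertible, it would be coercive and [r] could
    be lowered.  So [r] is itself an eigenvalue. *)
Lemma rayleigh_le_eigenvalue A (l : K) : A^T = A ->
    (forall m, eigenvalue A m -> m <= l) ->
  forall x, ip x (A *m x) <= l * ip x x.
Proof.
move=> As Al.
pose U := [set u : K | forall x, ip x (A *m x) <= u * ip x x].
have lbU x : x != 0 -> lbound U (ip x (A *m x) / ip x x).
  by move=> x0 u Uu; rewrite ler_pdivrMr ?ip_gt0.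
have [x0|] := pselect (forall x : 'cV[K]_n, x = 0).
  by move=> x; rewrite (x0 x) mulmx0 /ip mulmx0 mxtrace0 mulr0.
move=> /existsNP[v /eqP v0].
have Ubd : has_lbound U by exists (ip v (A *m v) / ip v v); apply: lbU.
have U0 : U !=set0.
  (* [ip A A] is a squared norm; adding 1 makes it exceed the norm itself *)
  exists (ip A A + 1) => x.
  have [->|x0] := eqVneq x 0; first by rewrite mulmx0 /ip mulmx0 mxtrace0 mulr0.
  rewrite real_leNgt ?num_real //; apply/negP => H.
  have := ip_CS x (A *m x); apply/negP; rewrite -ltNge.
  apply: le_lt_trans (_ : ip x x * ((ip A A + 1) * ip x x) < _).
    rewrite ler_wpM2l ?ip_ge0 // (le_trans (ip_mulmx_le _ _)) //.
    by rewrite ler_wpM2r ?ip_ge0 // lerDl.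
  apply: le_lt_trans (_ : ((ip A A + 1) * ip x x) ^+ 2 < _).
    rewrite exprMn expr2 -mulrA; have := ip_ge0 x; have := ip_ge0 A; nra.
  have c0 : 0 <= (ip A A + 1) * ip x x by rewrite mulr_ge0 ?addr_ge0 ?ip_ge0.
  by rewrite ltr_pXn2r ?nnegrE // (le_trans c0 (ltW H)).
set r := inf U.
have ge_r x : ip x (A *m x) <= r * ip x x.
  have [->|x0] := eqVneq x 0; first by rewrite mulmx0 /ip mulmx0 mxtrace0 mulr0.
  by rewrite -ler_pdivrMr ?ip_gt0 //; apply: lb_le_inf => //; apply: lbU.
suff er : eigenvalue A r.
  by move=> x; rewrite (le_trans (ge_r x)) // ler_wpM2r ?ip_ge0 ?Al.
apply: contraT => ner.
pose B := r%:M - A.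
have Bx x : ip x (B *m x) = r * ip x x - ip x (A *m x).
  by rewrite mulmxBl mul_scalar_mx ipDr ipNr ipZr.
have Bs : B^T = B by rewrite /B raddfB /= tr_scalar_mx As.
have Bu : B \in unitmx.
  rewrite -row_free_unit -kermx_eq0; apply: contraNT ner => kB.
  have /rowV0Pn[u uk u0] := kB; apply/eigenvalueP; exists u => //.
  move: uk => /sub_kermxP; rewrite mulmxBr mul_mx_scalar => /eqP.
  by rewrite subr_eq0 => /eqP.
have [x|b b0 Hb] := psd_unit_coercive Bs Bu.
  by rewrite Bx subr_ge0.
have : r <= r - b.
  apply: ge_inf => // x; have := Hb x; rewrite Bx; lra.
lra.
Qed.

(** The previous bound for [- A]. *)
Lemma rayleigh_ge_eigenvalue A (l : K) : A^T = A ->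
    (forall m, eigenvalue A m -> l <= m) ->
  forall x, l * ip x x <= ip x (A *m x).
Proof.
move=> As Al x.
have := @rayleigh_le_eigenvalue (- A) (- l).
rewrite raddfN /= As => /(_ erefl) H.
suff /H/(_ x) : forall m, eigenvalue (- A) m -> m <= - l.
  by rewrite mulNmx ipNr mulNr lerN2.
move=> m /eigenvalueP[v vA v0]; rewrite lerNr; apply: Al.
apply/eigenvalueP; exists v => //.
by rewrite scaleNr -vA mulmxN opprK.
Qed.

(** The square of a positive semidefinite matrix is bounded through
    Cauchy-Schwarz for its own quadratic form. *)
Lemma psd_mulmx_le A (l : K) : A^T = A ->
    (forall x, 0 <= ip x (A *m x) <= l * ip x x) ->
  forall x, ip (A *m x) (A *m x) <= l ^+ 2 * ip x x.
Proof.
move=> As Ab x; set y := A *m x.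
have Apos (z : 'cV_n) : 0 <= ip z (A *m z) by case/andP: (Ab z).
have Ale (z : 'cV_n) : ip z (A *m z) <= l * ip z z by case/andP: (Ab z).
have [y0|y0] := eqVneq y 0.
  by rewrite y0 [leLHS]/ip mulmx0 mxtrace0 mulr_ge0 ?sqr_ge0 ?ip_ge0.
have := psd_CS x y As Apos; rewrite -[ip x (A *m y)]ipC ip_mull As -/y => H.
rewrite -(ler_pM2r (ip_gt0 y0)) -expr2 (le_trans H) //.
rewrite (le_trans (ler_pM _ _ (Ale x) (Ale y))) //.
by rewrite mulrACA -expr2 mulrA.
Qed.

End RayleighQuotient.

(** * Rotations and the attitude error function *)

Section RotationMatrices.
Context {K : realType}.
Implicit Types (E A B R : 'M[K]_3) (x y : 'cV[K]_3).

Lemma tr_hat x : (hat x)^T = - hat x.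
Proof. by apply: matrix3P; split; rewrite !mxE /= ?oppr0 ?opprK. Qed.

Lemma SO3_mulmxT E : SO3 E -> E *m E^T = 1%:M.
Proof. by case=> ? _; exact: mulmx1C. Qed.

Lemma SO3_trmul A B : SO3 A -> SO3 B -> SO3 (A^T *m B).
Proof.
move=> SA [BB dB]; have [_ dA] := SA; split; last first.
  by rewrite det_mulmx det_tr dA dB mulr1.
by rewrite trmx_mul trmxK -mulmxA (mulmxA A) SO3_mulmxT // mul1mx.
Qed.

Lemma hat_SO3_mul E x : SO3 E -> hat x *m E = E *m hat (E^T *m x).
Proof.
move=> SE; have [_ dE] := SE; have := hat_conj E (E^T *m x).
rewrite mulmxA SO3_mulmxT // mul1mx dE scale1r => <-.
by rewrite !mulmxA SO3_mulmxT // mul1mx.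
Qed.

Lemma SO3_col_unit E j : SO3 E -> E 0 j ^+ 2 + E 1 j ^+ 2 + E 2 j ^+ 2 = 1.
Proof.
case=> /matrixP/(_ j j); rewrite mul3E !mxE eqxx => H _.
by rewrite !expr2.
Qed.

Lemma SO3_row_unit E i : SO3 E -> E i 0 ^+ 2 + E i 1 ^+ 2 + E i 2 ^+ 2 = 1.
Proof.
move=> /SO3_mulmxT/matrixP/(_ i i); rewrite mul3E !mxE eqxx => H.
by rewrite !expr2.
Qed.

(** Entries of [hat (E x) = E (hat x) E^T] at the basis vectors [x]: a rotation is
    its own cofactor matrix. *)
Lemma SO3_diag_cofactor E : SO3 E ->
  [/\ E 0 0 = E 1 1 * E 2 2 - E 1 2 * E 2 1,
      E 1 1 = E 0 0 * E 2 2 - E 0 2 * E 2 0 &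
      E 2 2 = E 0 0 * E 1 1 - E 0 1 * E 1 0].
Proof.
move=> SE; have H (x : 'cV[K]_3) : hat (E *m x) = E *m hat x *m E^T.
  rewrite -[LHS]mulmx1 -(SO3_mulmxT SE) mulmxA hat_SO3_mul // mulmxA.
  by case: SE => -> _; rewrite mul1mx.
split.
- have /matrixP/(_ 2 1) := H (col3 1 0 0).
  by rewrite mul3E !mxE /= !sum3E !mxE /= => E00; nra.
- have /matrixP/(_ 0 2) := H (col3 0 1 0).
  by rewrite mul3E !mxE /= !sum3E !mxE /= => E00; nra.
- have /matrixP/(_ 1 0) := H (col3 0 0 1).
  by rewrite mul3E !mxE /= !sum3E !mxE /= => E00; nra.
Qed.

Lemma SO3_diag_le1 E i : SO3 E -> `|E i i| <= 1.
Proof.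
move=> SE; have := SO3_row_unit i SE.
have [->|->|->] := ord3P i.
all: by rewrite ler_norml => H; apply/andP; split; nra.
Qed.

(** For a rotation of angle [theta] about the unit axis [n], this is
    [(1 - cos theta) (1 - n_i^2)]. *)
Definition angle_defect E (i : 'I_3) : K := 1 - E i i.

Lemma angle_defect_ge0 E i : SO3 E -> 0 <= angle_defect E i.
Proof. by move=> /(SO3_diag_le1 i); rewrite ler_norml subr_ge0 => /andP[]. Qed.

(** In terms of the axis and the angle, [p_1 + p_2 - p_0 = 2 (1 - cos theta) n_0^2].
    Without these parameters: for a rotation,
    [(1 + E_00)^2 - (E_11 + E_22)^2 = (E_21 - E_12)^2], by the unit rows and
    columns and the cofactor formula for [E_00]. *)
Lemma angle_defect_triangle E : SO3 E ->
  [/\ angle_defect E 0 <= angle_defect E 1 + angle_defect E 2,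
      angle_defect E 1 <= angle_defect E 2 + angle_defect E 0 &
      angle_defect E 2 <= angle_defect E 0 + angle_defect E 1].
Proof.
move=> SE; have [c0 c1 c2] := SO3_diag_cofactor SE.
have r0 := SO3_row_unit 0 SE; have r1 := SO3_row_unit 1 SE.
have r2 := SO3_row_unit 2 SE; have k0 := SO3_col_unit 0 SE.
have k1 := SO3_col_unit 1 SE; have k2 := SO3_col_unit 2 SE.
have := SO3_diag_le1 0 SE; have := SO3_diag_le1 1 SE.
have := SO3_diag_le1 2 SE; rewrite !ler_norml => /andP[l2 _] /andP[l1 _] /andP[l0 _].
have key (a b : K) : 0 <= 1 + a -> 0 <= (1 + a) ^+ 2 - b ^+ 2 -> b <= 1 + a.
  by move=> a0 ab; rewrite real_leNgt ?num_real //; apply/negP => h; nra.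
rewrite /angle_defect; split.
- suff : E 1 1 + E 2 2 <= 1 + E 0 0 by lra.
  apply: key; first by lra.
  rewrite (_ : _ - _ = (E 2 1 - E 1 2) ^+ 2) ?sqr_ge0 //; nra.
- suff : E 2 2 + E 0 0 <= 1 + E 1 1 by lra.
  apply: key; first by lra.
  rewrite (_ : _ - _ = (E 0 2 - E 2 0) ^+ 2) ?sqr_ge0 //; nra.
- suff : E 0 0 + E 1 1 <= 1 + E 2 2 by lra.
  apply: key; first by lra.
  rewrite (_ : _ - _ = (E 1 0 - E 0 1) ^+ 2) ?sqr_ge0 //; nra.
Qed.

End RotationMatrices.

Section AttitudeError.
Context {K : realType} (g1 g2 g3 : K).
Hypotheses (g1_gt0 : 0 < g1) (g2_gt0 : 0 < g2) (g3_gt0 : 0 < g3).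
Implicit Types (E R : 'M[K]_3) (x y : 'cV[K]_3).

Local Notation G := (diag3 g1 g2 g3).

(** [e_R] as a function of the relative attitude, on which it depends linearly;
    hence its derivative is its value at the derivative of [E]. *)
Definition attitude_error (A E : 'M[K]_3) : 'cV[K]_3 :=
  2^-1 *: vee (A *m E - E^T *m A).

Lemma e_RE (A R Rd : 'M[K]_3) : e_R A R Rd = attitude_error A (Rd^T *m R).
Proof. by rewrite /e_R /attitude_error trmx_mul trmxK !mulmxA. Qed.

(** The attitude error function usually written [Psi]. *)
Definition navigation (A E : 'M[K]_3) : K := 2^-1 * \tr (A *m (1%:M - E)).

Lemma navigationE E : navigation G E = 2^-1 *
  (g1 * angle_defect E 0 + g2 * angle_defect E 1 + g3 * angle_defect E 2).
Proof. by rewrite /navigation tr3E /diag3 !mul_diag_mx !mxE /=. Qed.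

Lemma attitude_errorE E : attitude_error G E = 2^-1 *:
  col3 (g3 * E 2 1 - g2 * E 1 2) (g1 * E 0 2 - g3 * E 2 0) (g2 * E 1 0 - g1 * E 0 1).
Proof.
rewrite /attitude_error /diag3 mul_diag_mx mul_mx_diag.
by congr (_ *: col3 _ _ _); rewrite !mxE /=; ring.
Qed.

(** Split the off-diagonal entries of [E] into antisymmetric parts [a_i] and
    symmetric parts [s_i].  Then [4 |eR|^2] is the sum of the
    [(g_j + g_k)^2 a_i^2] and of the [(g_j - g_k)^2 s_i^2], plus cross terms which
    vanish: equality of row and column norms gives
    [a_0 s_0 = a_1 s_1 = a_2 s_2], and their coefficients [g_k^2 - g_j^2] add up
    to zero.  So [|eR|^2] is at most [(h2 + h3) / 4] times the sum of the defects
    [p_i].  Conversely [4 Psi] is the sum of the [(p_j + p_k - p_i) (g_j + g_k)],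
    whose first factors are nonnegative, so it is at least [h1] times that sum. *)
Lemma navigation_ge E : SO3 E ->
  b1 g1 g2 g3 * ip (attitude_error G E) (attitude_error G E) <= navigation G E.
Proof.
move=> SE; rewrite /b1.
set h1 : K := Num.min _ _; set h2 : K := Num.max _ (_ ^+ 2).
set h3 : K := Num.max _ ((_ + _) ^+ 2).
have [h1a h1b h1c] : [/\ h1 <= g1 + g2, h1 <= g2 + g3 & h1 <= g3 + g1].
  by rewrite /h1 !ge_min !lexx ?orbT.
have [h2a h2b h2c] :
    [/\ (g1 - g2) ^+ 2 <= h2, (g2 - g3) ^+ 2 <= h2 & (g3 - g1) ^+ 2 <= h2].
  by rewrite /h2 !le_max !lexx ?orbT.
have [h3a h3b h3c] :
    [/\ (g1 + g2) ^+ 2 <= h3, (g2 + g3) ^+ 2 <= h3 & (g3 + g1) ^+ 2 <= h3].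
  by rewrite /h3 !le_max !lexx ?orbT.
have h10 : 0 <= h1 by rewrite /h1 !le_min !addr_ge0 // ltW.
have h20 : 0 <= h2 by rewrite (le_trans _ h2a) ?sqr_ge0.
have h30 : 0 < h3 by rewrite (lt_le_trans _ h3a) // exprn_gt0 // addr_gt0.
clearbody h1 h2 h3.
have h0 : 0 < h2 + h3 by rewrite ltr_wpDl.
set p := angle_defect E.
have err_le : ip (attitude_error G E) (attitude_error G E) <=
    (h2 + h3) / 4 * (p 0 + p 1 + p 2).
  rewrite attitude_errorE ipZl ipZr ip_colE sum3E !mxE /=.
  have r0 := SO3_row_unit 0 SE; have r1 := SO3_row_unit 1 SE.
  have r2 := SO3_row_unit 2 SE; have k0 := SO3_col_unit 0 SE.
  have k1 := SO3_col_unit 1 SE; have k2 := SO3_col_unit 2 SE.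
  pose a0 := (E 2 1 - E 1 2) / 2; pose s0 := (E 2 1 + E 1 2) / 2.
  pose a1 := (E 0 2 - E 2 0) / 2; pose s1 := (E 0 2 + E 2 0) / 2.
  pose a2 := (E 1 0 - E 0 1) / 2; pose s2 := (E 1 0 + E 0 1) / 2.
  have e1 : a1 * s1 = a0 * s0 by rewrite /a1 /s1 /a0 /s0; lra.
  have e2 : a2 * s2 = a0 * s0 by rewrite /a2 /s2 /a0 /s0; lra.
  rewrite [X in X <= _](_ : _ = 4^-1 *
      ((g2 + g3) ^+ 2 * a0 ^+ 2 + (g2 - g3) ^+ 2 * s0 ^+ 2
     + (g3 + g1) ^+ 2 * a1 ^+ 2 + (g3 - g1) ^+ 2 * s1 ^+ 2
     + (g1 + g2) ^+ 2 * a2 ^+ 2 + (g1 - g2) ^+ 2 * s2 ^+ 2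
     + 2 * ((g3 ^+ 2 - g2 ^+ 2) * (a0 * s0) + (g1 ^+ 2 - g3 ^+ 2) * (a1 * s1)
          + (g2 ^+ 2 - g1 ^+ 2) * (a2 * s2)))); last first.
    by rewrite /a0 /a1 /a2 /s0 /s1 /s2; field.
  (* all cross terms now share the factor a0 * s0 and cancel *)
  rewrite e1 e2.
  have le_h (u v w : K) : u <= v -> u * w ^+ 2 <= v * w ^+ 2.
    by move=> uv; rewrite ler_wpM2r ?sqr_ge0.
  have := le_h _ _ a0 h3b; have := le_h _ _ a1 h3c; have := le_h _ _ a2 h3a.
  have := le_h _ _ s0 h2b; have := le_h _ _ s1 h2c; have := le_h _ _ s2 h2a.
  have sumsq : a0 ^+ 2 + a1 ^+ 2 + a2 ^+ 2 + (s0 ^+ 2 + s1 ^+ 2 + s2 ^+ 2) =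
      (3 - E 0 0 ^+ 2 - E 1 1 ^+ 2 - E 2 2 ^+ 2) / 2.
    rewrite /a0 /a1 /a2 /s0 /s1 /s2; nra.
  have sq_le : a0 ^+ 2 + a1 ^+ 2 + a2 ^+ 2 + (s0 ^+ 2 + s1 ^+ 2 + s2 ^+ 2) <=
      p 0 + p 1 + p 2.
    rewrite sumsq /p /angle_defect.
    have := sqr_ge0 (E 0 0 - 1); have := sqr_ge0 (E 1 1 - 1).
    have := sqr_ge0 (E 2 2 - 1); lra.
  have m0 : 0 <= (h2 + h3) * (p 0 + p 1 + p 2 - (a0 ^+ 2 + a1 ^+ 2 + a2 ^+ 2
      + (s0 ^+ 2 + s1 ^+ 2 + s2 ^+ 2))) by rewrite mulr_ge0 ?subr_ge0 // ltW.
  have m1 : 0 <= h3 * (s0 ^+ 2 + s1 ^+ 2 + s2 ^+ 2).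
    by rewrite mulr_ge0 ?addr_ge0 ?sqr_ge0 // ltW.
  have m2 : 0 <= h2 * (a0 ^+ 2 + a1 ^+ 2 + a2 ^+ 2).
    by rewrite mulr_ge0 ?addr_ge0 ?sqr_ge0.
  move: (p 0) (p 1) (p 2) m0 m1 m2 => p0 p1 p2; lra.
rewrite navigationE.
apply: (@le_trans _ _ (h1 / 4 * (p 0 + p 1 + p 2))).
  apply: le_trans (ler_wpM2l _ err_le) _; first exact: divr_ge0 h10 (ltW h0).
  by rewrite le_eqVlt; apply/orP; left; apply/eqP; field; rewrite gt_eqF.
have [] := angle_defect_triangle SE; rewrite /p.
move: (angle_defect E 0) (angle_defect E 1) (angle_defect E 2) => p0 p1 p2.
move=> t0 t1 t2.
have q0 : 0 <= (p1 + p2 - p0) * (g2 + g3 - h1) by apply: mulr_ge0; lra.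
have q1 : 0 <= (p2 + p0 - p1) * (g3 + g1 - h1) by apply: mulr_ge0; lra.
have q2 : 0 <= (p0 + p1 - p2) * (g1 + g2 - h1) by apply: mulr_ge0; lra.
lra.
Qed.

End AttitudeError.

(** * Kinematic identities and bounds *)

Section HatIdentities.
Context {K : realType}.
Implicit Types (A B E M : 'M[K]_3) (x y : 'cV[K]_3).

Lemma hat_anticommutator B x :
  hat x *m B + B^T *m hat x = hat (((\tr B)%:M - B) *m x).
Proof.
rewrite tr3E; apply: matrix3P; split; rewrite [LHS]mxE !mul3E !mxE /= ?sum3E ?mxE /=.
all: ring.
Qed.

Lemma tr_mul_hat M x : \tr (M *m hat x) = - ip (vee (M - M^T)) x.
Proof. by rewrite tr3E !mul3E ip_colE sum3E !mxE /=; ring. Qed.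

(** The power [- e . (P a + w x P w)] that the inertia error feeds into the tracking
    errors is linear in [P]; the update law moves the estimate along its gradient
    among symmetric matrices. *)
Lemma adaptation_work (P : 'M[K]_3) (a w e : 'cV[K]_3) : P^T = P ->
  ip P (- (a *m e^T) - e *m a^T + w *m w^T *m hat e - hat e *m w *m w^T)
  = - (2 * ip e (P *m a + cross w (P *m w))).
Proof.
move=> /matrixP Ps; have sP i j : P i j = P j i by have := Ps j i; rewrite mxE.
rewrite [in RHS]ip_colE ipE !sum3E.
rewrite !(mxE, sum3E, big_ord1) /=.
rewrite (sP 1 0) (sP 2 0) (sP 2 1).
ring.
Qed.

End HatIdentities.

Section AttitudeErrorKinematics.
Context {K : realType}.
Implicit Types (A E R Rd : 'M[K]_3) (x : 'cV[K]_3).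

(** The matrix [C] such that [eR' = C e]. *)
Definition attitude_rate A E : 'M[K]_3 :=
  2^-1 *: ((\tr (E^T *m A))%:M - E^T *m A).

Lemma attitude_error_hat A E x : A^T = A ->
  attitude_error A (E *m hat x) = attitude_rate A E *m x.
Proof.
move=> As; rewrite /attitude_error /attitude_rate -scalemxAl; congr (_ *: _).
rewrite -[RHS]hatK -hat_anticommutator; congr vee.
by rewrite !trmx_mul trmxK As tr_hat mulNmx mulNmx opprK !mulmxA addrC.
Qed.

Lemma navigation_hat A E x : A^T = A ->
  \tr (A *m (E *m hat x)) = - (2 * ip (attitude_error A E) x).
Proof.
move=> As; rewrite mulmxA tr_mul_hat /attitude_error ipZl mulrA divff ?mul1r //.
by rewrite trmx_mul As.
Qed.

Lemma ip_sub_SO3 R Rd : SO3 Rd ->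
  ip (R - Rd) (R - Rd) = ip (1%:M - Rd^T *m R) (1%:M - Rd^T *m R).
Proof.
move=> SRd; have [RdRd _] := SRd.
have -> : R - Rd = - (Rd *m (1%:M - Rd^T *m R)).
  by rewrite mulmxBr mulmx1 mulmxA SO3_mulmxT // mul1mx opprB.
by rewrite ipNl ipNr opprK ip_mull mulmxA RdRd mul1mx.
Qed.

Lemma ip_one_sub_SO3 E : SO3 E ->
  ip (1%:M - E) (1%:M - E) =
  2 * (angle_defect E 0 + angle_defect E 1 + angle_defect E 2).
Proof.
move=> [EE _]; rewrite ipDl !ipDr !ipNl !ipNr (ipC E 1%:M) {1 2 3 4}/ip.
rewrite EE trmx1 !mul1mx mxtrace1 tr3E /angle_defect; ring.
Qed.

End AttitudeErrorKinematics.

Section AttitudeErrorBounds.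
Context {K : realType} (g1 g2 g3 : K).
Hypotheses (g1_gt0 : 0 < g1) (g2_gt0 : 0 < g2) (g3_gt0 : 0 < g3).
Implicit Types (E R : 'M[K]_3) (x y : 'cV[K]_3).

Local Notation G := (diag3 g1 g2 g3).

Lemma tr_diag3 : \tr G = g1 + g2 + g3.
Proof. by rewrite tr3E !mxE. Qed.

(** The Frobenius norm of the rate matrix is explicit: four times its square is
    [(tr (E^T G))^2 + tr (G^2)], and both terms are at most [(tr G)^2]. *)
Lemma attitude_rate_bound E x : SO3 E ->
  ip (attitude_rate G E *m x) (attitude_rate G E *m x)
  <= (\tr G) ^+ 2 / 2 * ip x x.
Proof.
move=> SE; apply: (le_trans (ip_mulmx_le _ _)); rewrite ler_wpM2r ?ip_ge0 //.
rewrite /attitude_rate; set B := E^T *m G.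
have BB : ip B B = g1 ^+ 2 + g2 ^+ 2 + g3 ^+ 2.
  rewrite ip_mull trmxK mulmxA SO3_mulmxT // mul1mx.
  by rewrite ipE !sum3E !mxE /=; ring.
have tB : \tr B = g1 * E 0 0 + g2 * E 1 1 + g3 * E 2 2.
  by rewrite tr3E /B mul_mx_diag !mxE /=; ring.
have tr1B : ip (1%:M : 'M[K]_3) B = \tr B by rewrite /ip trmx1 mul1mx.
have ip11 : ip (1%:M : 'M[K]_3) 1%:M = 3 by rewrite /ip trmx1 mul1mx mxtrace1.
rewrite ipZl ipZr.
rewrite -[(\tr B)%:M]scalemx1 ipDl !ipDr !ipNl !ipNr !ipZl !ipZr ip11.
rewrite [ip B 1%:M]ipC tr1B BB.
have tle : `|\tr B| <= \tr G.
  have le_g (g : K) i : 0 < g -> `|g * E i i| <= g.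
    move=> g0; rewrite normrM gtr0_norm //.
    by apply: ler_piMr; [exact: ltW | exact: SO3_diag_le1].
  rewrite tB tr_diag3 (le_trans (ler_normD _ _)) // lerD ?le_g //.
  by rewrite (le_trans (ler_normD _ _)) // lerD ?le_g.
have tle2 : \tr B ^+ 2 <= \tr G ^+ 2.
  by rewrite -[_ ^+ 2]real_normK ?num_real // lerXn2r ?nnegrE // (le_trans _ tle).
have := mulr_gt0 g1_gt0 g2_gt0; have := mulr_gt0 g2_gt0 g3_gt0.
have := mulr_gt0 g3_gt0 g1_gt0.
move: tle2; rewrite tr_diag3; move: (\tr B) => t; lra.
Qed.

Lemma navigation_ge0 E : SO3 E -> 0 <= navigation G E.
Proof.
move=> SE; have H (g : K) i : 0 < g -> 0 <= g * angle_defect E i.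
  by move=> g0; rewrite mulr_ge0 ?angle_defect_ge0 // ltW.
by rewrite navigationE mulr_ge0 // !addr_ge0 // H.
Qed.

Lemma navigation_le E : SO3 E ->
  navigation G E <= \tr G / 4 * ip (1%:M - E) (1%:M - E).
Proof.
move=> SE; rewrite navigationE ip_one_sub_SO3 // tr_diag3.
have := angle_defect_ge0 0 SE; have := angle_defect_ge0 1 SE.
have := angle_defect_ge0 2 SE.
move: (angle_defect E 0) (angle_defect E 1) (angle_defect E 2) => p0 p1 p2.
move=> h2 h1 h0.
have m (g p : K) : 0 < g -> 0 <= p -> 0 <= g * p.
  by move=> g0 p0'; rewrite mulr_ge0 // ltW.
have := m _ _ g1_gt0 h1; have := m _ _ g1_gt0 h2; have := m _ _ g2_gt0 h0.
have := m _ _ g2_gt0 h2; have := m _ _ g3_gt0 h0; have := m _ _ g3_gt0 h1.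
lra.
Qed.

(** Among rotations [Psi], unlike [eR], vanishes only at the identity; this is
    what turns a bound on [Psi] into closeness of [R] and [Rd]. *)
Lemma navigation_ge_dist E : SO3 E ->
  Num.min (Num.min g1 g2) g3 / 4 * ip (1%:M - E) (1%:M - E) <= navigation G E.
Proof.
move=> SE; rewrite navigationE ip_one_sub_SO3 //.
set g : K := Num.min _ _.
have [h1 h2 h3] : [/\ g <= g1, g <= g2 & g <= g3].
  by rewrite /g !ge_min !lexx ?orbT.
clearbody g.
have := angle_defect_ge0 0 SE; have := angle_defect_ge0 1 SE.
have := angle_defect_ge0 2 SE.
move: (angle_defect E 0) (angle_defect E 1) (angle_defect E 2) => p0 p1 p2.
move=> d2 d1 d0.
have m (u p : K) : g <= u -> 0 <= p -> 0 <= (u - g) * p.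
  by move=> gu p0'; rewrite mulr_ge0 ?subr_ge0.
have := m _ _ h1 d0; have := m _ _ h2 d1; have := m _ _ h3 d2; lra.
Qed.

End AttitudeErrorBounds.

(** * The Lyapunov function as an algebraic expression *)

(** [X], [Y] and [s] stand for [|x|^2], [|y|^2] and [x . y], so that Cauchy-Schwarz
    is the only link between them and no square root is taken. *)
Lemma quadratic_form_coercive (K : realType) (a b d : K) :
    0 < a -> 0 < d -> b ^+ 2 < 4 * a * d ->
  exists2 mu, 0 < mu & forall X Y s : K, 0 <= X -> 0 <= Y -> s ^+ 2 <= X * Y ->
    mu * (X + Y) <= a * X + d * Y + b * s.
Proof.
move=> a0 d0 bad; have ad0 : 0 < a + d by rewrite addr_gt0.
(* chosen so that (a - mu) (d - mu) = b^2 / 4 + mu^2 *)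
pose mu := (a * d - b ^+ 2 / 4) / (a + d).
have mu_ad : mu * (a + d) = a * d - b ^+ 2 / 4 by rewrite divfK // gt_eqF.
have mu0 : 0 < mu by rewrite divr_gt0 //; lra.
exists mu => // X Y s X0 Y0 sXY.
have a1 : 0 <= a - mu.
  rewrite subr_ge0 ler_pdivrMr //; have := sqr_ge0 b; nra.
have d1 : 0 <= d - mu.
  rewrite subr_ge0 ler_pdivrMr //; have := sqr_ge0 b; nra.
have disc : b ^+ 2 <= 4 * ((a - mu) * (d - mu)).
  have := sqr_ge0 mu; nra.
pose T := (a - mu) * X + (d - mu) * Y.
have T0 : 0 <= T by rewrite addr_ge0 // mulr_ge0.
have bsT : (b * s) ^+ 2 <= T ^+ 2.
  rewrite exprMn (le_trans (ler_pM (sqr_ge0 _) (sqr_ge0 _) disc sXY)) //.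
  rewrite /T -subr_ge0 [leRHS](_ : _ = ((a - mu) * X - (d - mu) * Y) ^+ 2).
    exact: sqr_ge0.
  ring.
have : `|b * s| <= T.
  by rewrite -(@ler_pXn2r _ 2) ?nnegrE // real_normK ?num_real.
by rewrite ler_norml /T => /andP[+ _]; lra.
Qed.

Section Lyapunov.
Context {K : realType} (J : 'M[K]_3) (g1 g2 g3 kR kOm kJ c : K).
Local Notation G := (diag3 g1 g2 g3).
Local Notation b1 := (b1 g1 g2 g3).
Local Notation eR E := (attitude_error G E).
Implicit Types (E P : 'M[K]_3) (e w a : 'cV[K]_3).

(** Kinetic energy in [e], cross term, potential and parameter error, after
    completing the square: [1/2 e . J e + c eR . J e] is
    [1/2 eA . J eA - c^2/2 eR . J eR] with [eA = e + c eR]. *)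
Definition lyapunov E e P : K :=
  2^-1 * ip (e + c *: eR E) (J *m (e + c *: eR E))
  - c ^+ 2 / 2 * ip (eR E) (J *m eR E)
  + kR * navigation G E + (2 * kJ)^-1 * ip P P.

(** The left-hand side is the derivative of [lyapunov]; on the right no trace of
    [P] is left. *)
Lemma lyapunov_balance E e P w a de : J^T = J -> P^T = P -> kJ != 0 ->
    J *m de = - (kR *: eR E) - kOm *: e - cross w (P *m w) - P *m a ->
  let eA := e + c *: eR E in
  let deR := attitude_rate G E *m e in
  ip eA (J *m (de + c *: deR)) - c ^+ 2 * ip (eR E) (J *m deR)
  + kR * ip (eR E) e
  + kJ^-1 * ip P (- ((kJ / 2) *: (- (a *m eA^T) - eA *m a^T
       + w *m w^T *m hat eA - hat eA *m w *m w^T)))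
  = - (kOm * ip e e + c * kR * ip (eR E) (eR E) + c * kOm * ip (eR E) e)
    + c * ip e (J *m deR).
Proof.
move=> Js Ps kJ0 + eA deR; rewrite /eA; move: (eR E) => r Jde.
rewrite ipNr ipZr adaptation_work // mulmxDr Jde -scalemxAr.
rewrite !ipDr !ipNr !ipZr !ipDl !ipZl (ipC e r).
by field.
Qed.

Hypotheses (g1_gt0 : 0 < g1) (g2_gt0 : 0 < g2) (g3_gt0 : 0 < g3).
Hypotheses (kR_gt0 : 0 < kR) (kOm_gt0 : 0 < kOm) (kJ_gt0 : 0 < kJ).
Hypothesis c_gt0 : 0 < c.
Variables lm lM : K.
Hypotheses (lm_gt0 : 0 < lm) (lm_lM : lm <= lM).
Hypothesis J_sym : J^T = J.
Hypothesis J_ge : forall x : 'cV[K]_3, lm * ip x x <= ip x (J *m x).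
Hypothesis J_le : forall x : 'cV[K]_3, ip x (J *m x) <= lM * ip x x.

(** The indefinite term is at most [c lM tr G / sqrt 2] times [|e|^2]; negative
    definiteness of the remaining form in [(|e|, |eR|)] is the discriminant
    condition, that is, the bound on [c]. *)
Lemma lyapunov_dissipation :
    c * (kOm ^+ 2 + 2 * Num.sqrt 2 * kR * lM * \tr G) < 4 * kR * kOm ->
  exists2 mu, 0 < mu & forall E e, SO3 E ->
    - (kOm * ip e e + c * kR * ip (eR E) (eR E) + c * kOm * ip (eR E) e)
    + c * ip e (J *m (attitude_rate G E *m e))
    <= - (mu * (ip e e + ip (eR E) (eR E))).
Proof.
move=> cbound; set s := Num.sqrt 2 in cbound.
have ss : s ^+ 2 = 2 by rewrite sqr_sqrtr.
have s0 : 0 < s by rewrite sqrtr_gt0.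
have lM0 : 0 < lM by apply: lt_le_trans lm_lM.
have t0 : 0 < \tr G by rewrite tr_diag3 !addr_gt0.
move: t0 cbound (@attitude_rate_bound _ _ _ _ g1_gt0 g2_gt0 g3_gt0).
move: (\tr G) => t t0 cbound rate_le.
pose A := kOm - c * lM * t * s / 2.
have A0 : 0 < A.
  suff : 0 < 4 * kR * A by rewrite pmulr_rgt0 // mulr_gt0.
  have := mulr_gt0 c_gt0 (exprn_gt0 2 kOm_gt0).
  rewrite /A; lra.
have ckR : 0 < c * kR by rewrite mulr_gt0.
have [|mu mu0 Hmu] := @quadratic_form_coercive _ A (c * kOm) (c * kR) A0 ckR.
  have := mulr_gt0 c_gt0 (_ : 0 < 4 * kR * kOm - c * (kOm ^+ 2 + 2 * s * kR * lM * t)).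
  by rewrite subr_gt0 => /(_ cbound); rewrite /A; lra.
exists mu => // E e SE.
set X := ip e e; set Y := ip (eR E) (eR E).
set Ce := attitude_rate G E *m e.
have JCe : ip e (J *m Ce) <= lM * t * s / 2 * X.
  rewrite -[J in J *m Ce]J_sym -ip_mull.
  have r0 : 0 <= lM * t * s / 2 * X by rewrite !mulr_ge0 ?ip_ge0 // ltW.
  suff : `|ip (J *m e) Ce| <= lM * t * s / 2 * X by apply: le_trans; exact: ler_norm.
  rewrite -(@ler_pXn2r _ 2) ?nnegrE // real_normK ?num_real //.
  apply: (le_trans (ip_CS _ _)).
  have Jb (z : 'cV[K]_3) : 0 <= ip z (J *m z) <= lM * ip z z.
    by rewrite J_le andbT (le_trans _ (J_ge z)) // mulr_ge0 ?ip_ge0 // ltW.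
  apply: le_trans (ler_pM (ip_ge0 _) (ip_ge0 _) (psd_mulmx_le J_sym Jb e)
                    (rate_le E e SE)) _.
  rewrite -/X le_eqVlt; apply/orP; left; apply/eqP.
  by rewrite !exprMn ss; field.
have := Hmu X Y (ip (eR E) e) (ip_ge0 _) (ip_ge0 _).
rewrite [X * Y]mulrC => /(_ (ip_CS _ _)).
have := ler_wpM2l (ltW c_gt0) JCe; rewrite /A; lra.
Qed.

Lemma b1_gt0 : 0 < b1.
Proof.
apply: divr_gt0; first by rewrite !lt_min !addr_gt0.
rewrite ltr_wpDl ?le_max ?lt_max ?sqr_ge0 //.
by rewrite exprn_gt0 // addr_gt0.
Qed.

Lemma ip_attitude_error_le E : SO3 E ->
  ip (eR E) (eR E) <= b1^-1 * navigation G E.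
Proof.
by move=> SE; rewrite ler_pdivlMl ?b1_gt0 // navigation_ge.
Qed.

Lemma ip_add_le (x y : 'cV[K]_3) : ip (x + y) (x + y) <= 2 * ip x x + 2 * ip y y.
Proof.
have := ip_ge0 (x - y); rewrite !(ipDl, ipDr, ipNl, ipNr) (ipC y x); lra.
Qed.

(** The negative term [- c^2/2 eR . J eR] is absorbed by a proper fraction of
    [kR Psi], because [|eR|^2 <= Psi / b1] and [c^2 lM < 2 b1 kR]. *)
Lemma lyapunov_lower : c ^+ 2 * lM ^+ 2 < 2 * b1 * kR * lm ->
  exists2 m, 0 < m & forall E e P, SO3 E ->
    m * (ip e e + navigation G E + ip P P) <= lyapunov E e P.
Proof.
move=> cbound; have b0 := b1_gt0.
have lM0 : 0 < lM by apply: lt_le_trans lm_lM.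
pose k := kR - c ^+ 2 * lM / 2 / b1.
have k0 : 0 < k.
  rewrite subr_gt0 ltr_pdivrMr // -(ltr_pM2r lM0).
  have := ler_wpM2l (ltW (mulr_gt0 b0 kR_gt0)) lm_lM; lra.
pose q := 1 + 2 * c ^+ 2 / b1.
have q0 : 0 < q by rewrite addr_gt0 // divr_gt0 // mulr_gt0 // exprn_gt0.
pose m := Num.min (lm / 4) (Num.min (k / q) (2 * kJ)^-1).
have m0 : 0 < m by rewrite !lt_min !divr_gt0 ?invr_gt0 ?mulr_gt0.
exists m => // E e P SE; rewrite /lyapunov.
have [m1 m2 m3] : [/\ m <= lm / 4, m * q <= k & m <= (2 * kJ)^-1].
  by rewrite -ler_pdivlMr // /m !ge_min !lexx ?orbT.
have N0 := navigation_ge0 g1_gt0 g2_gt0 g3_gt0 SE.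
have RN := ip_attitude_error_le SE.
set eA := e + c *: eR E.
have e_le : ip e e <= 2 * ip eA eA + 2 * c ^+ 2 / b1 * navigation G E.
  have := ip_add_le eA (- (c *: eR E)).
  rewrite addrK ipNl ipNr opprK ipZl ipZr.
  have := ler_wpM2l (sqr_ge0 c) RN; lra.
have JR : c ^+ 2 / 2 * ip (eR E) (J *m eR E) <= c ^+ 2 * lM / 2 / b1 * navigation G E.
  have := ler_wpM2l (_ : 0 <= c ^+ 2 / 2) (le_trans (J_le (eR E)) (ler_wpM2l (ltW lM0) RN)).
  by rewrite divr_ge0 ?sqr_ge0 // => /(_ isT); lra.
have JA := J_ge eA.
have h1 : m * ip e e <= m * (2 * ip eA eA + (q - 1) * navigation G E).
  by rewrite ler_wpM2l ?(ltW m0) // /q [1 + _]addrC addrK.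
have h2 := ler_wpM2r (ip_ge0 eA) m1.
have h3 := ler_wpM2r N0 m2.
have h4 := ler_wpM2r (ip_ge0 P) m3.
move: h1 h2 h3 h4 JA JR; rewrite /k.
move: (2 * kJ)^-1 (ip eA eA) (navigation G E) (ip P P) => u X N Y.
move: (c ^+ 2 * lM / 2 / b1) (c ^+ 2 / 2 * _) => y z.
lra.
Qed.

Lemma lyapunov_upper :
  exists2 M, 0 < M & forall E e P, SO3 E ->
    lyapunov E e P <= M * (ip e e + navigation G E + ip P P).
Proof.
have b0 := b1_gt0.
have lM0 : 0 < lM by apply: lt_le_trans lm_lM.
pose v := lM * c ^+ 2 / b1; pose u := (2 * kJ)^-1.
have v0 : 0 < v by rewrite divr_gt0 // mulr_gt0 // exprn_gt0.
have u0 : 0 < u by rewrite invr_gt0 mulr_gt0.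
exists (lM + v + kR + u); first by rewrite !addr_gt0.
move=> E e P SE; rewrite /lyapunov -/u.
have N0 := navigation_ge0 g1_gt0 g2_gt0 g3_gt0 SE.
have RN := ip_attitude_error_le SE.
set eA := e + c *: eR E.
have JR : 0 <= c ^+ 2 / 2 * ip (eR E) (J *m eR E).
  rewrite mulr_ge0 ?divr_ge0 ?sqr_ge0 // (le_trans _ (J_ge _)) //.
  by rewrite mulr_ge0 ?ip_ge0 // ltW.
have eA_le : lM / 2 * ip eA eA <= lM * ip e e + v * navigation G E.
  have h1 := ler_wpM2l (_ : 0 <= lM / 2) (ip_add_le e (c *: eR E)).
  have := h1 _; rewrite divr_ge0 ?(ltW lM0) // => /(_ isT).
  rewrite ipZl ipZr -/eA.
  have := ler_wpM2l (_ : 0 <= lM * c ^+ 2) RN.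
  rewrite mulr_ge0 ?(ltW lM0) ?sqr_ge0 // => /(_ isT).
  rewrite /v; lra.
have JA := J_le eA.
have pos (x y : K) : 0 < x -> 0 <= y -> 0 <= x * y by move=> *; rewrite mulr_ge0 // ltW.
have p1 := pos _ _ v0 (ip_ge0 e); have p2 := pos _ _ kR_gt0 (ip_ge0 e).
have p3 := pos _ _ u0 (ip_ge0 e); have p4 := pos _ _ lM0 N0.
have p5 := pos _ _ u0 N0; have p6 := pos _ _ lM0 (ip_ge0 P).
have p7 := pos _ _ v0 (ip_ge0 P); have p8 := pos _ _ kR_gt0 (ip_ge0 P).
move: JR eA_le JA p1 p2 p3 p4 p5 p6 p7 p8.
move: (ip eA eA) (navigation G E) (ip P P) (ip e e) => X N Y Z.
move: (c ^+ 2 / 2 * _) (ip eA _) => z x; clearbody u v; clear => *; lra.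
Qed.

End Lyapunov.

(** * Calculus of matrix-valued functions and the Barbalat argument *)

Section MatrixCalculus.
Context {K : realType}.

Lemma is_derive_mxP m n (M : K -> 'M[K]_(m, n)) t (D : 'M[K]_(m, n)) :
  is_derive t (1 : K) M D <-> forall i j, is_derive t (1 : K) (fun s => M s i j) (D i j).
Proof.
split=> [[dM <-] i j|H].
  split; first exact: (derivable_mxP M t 1).1.
  by rewrite derive_mx // mxE.
have dM : derivable M t 1 by apply/derivable_mxP => i j; case: (H i j).
by split=> //; rewrite derive_mx //; apply/matrixP => i j; rewrite mxE; case: (H i j).
Qed.

Lemma is_derive_derive1 m n (M : K -> 'M[K]_(m, n)) t :
  derivable M t 1 -> is_derive t (1 : K) M (derive1 M t).
Proof. by move=> /derivableP; rewrite derive1E. Qed.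

Lemma is_derive_mulmx m n p (A : K -> 'M[K]_(m, n)) (B : K -> 'M[K]_(n, p)) t dA dB :
  is_derive t (1 : K) A dA -> is_derive t (1 : K) B dB ->
  is_derive t (1 : K) (fun s => A s *m B s) (dA *m B t + A t *m dB).
Proof.
move=> /is_derive_mxP hA /is_derive_mxP hB; apply/is_derive_mxP => i j.
rewrite (_ : (fun s => _) = \sum_k ((fun s => A s i k) * (fun s => B s k j))); last first.
  by apply/funext => s; rewrite mxE fct_sumE.
rewrite !mxE -big_split /=.
apply: is_derive_sum => k.
apply: (is_derive_eq (is_deriveM (hA i k) (hB k j))).
by rewrite addrC; congr (_ + _); exact: mulrC.
Qed.

Lemma is_derive_trmx m n (A : K -> 'M[K]_(m, n)) t dA :
  is_derive t (1 : K) A dA -> is_derive t (1 : K) (fun s => (A s)^T) dA^T.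
Proof.
move=> /is_derive_mxP hA; apply/is_derive_mxP => i j.
rewrite (_ : (fun s => _) = (fun s => A s j i)); last by apply/funext => s; rewrite mxE.
by rewrite mxE.
Qed.

Lemma is_derive_vee (A : K -> 'M[K]_3) t dA :
  is_derive t (1 : K) A dA -> is_derive t (1 : K) (fun s => vee (A s)) (vee dA).
Proof.
move=> /is_derive_mxP hA; apply/is_derive_mxP => i j.
rewrite mxE; case: i => -[|[|[|//]]] Hi /=;
  by under eq_fun do rewrite mxE /=; apply: hA.
Qed.

Lemma is_derive_mxtrace n (A : K -> 'M[K]_n) t dA :
  is_derive t (1 : K) A dA -> is_derive t (1 : K) (fun s => \tr (A s)) (\tr dA).
Proof.
move=> /is_derive_mxP hA.
rewrite (_ : (fun s => _) = \sum_k (fun s => A s k k)); last first.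
  by apply/funext => s; rewrite fct_sumE.
by apply: is_derive_sum => k.
Qed.

Lemma is_derive_ip m n (A B : K -> 'M[K]_(m, n)) t dA dB :
  is_derive t (1 : K) A dA -> is_derive t (1 : K) B dB ->
  is_derive t (1 : K) (fun s => ip (A s) (B s)) (ip dA (B t) + ip (A t) dB).
Proof.
move=> hA hB; rewrite /ip -mxtraceD; apply: is_derive_mxtrace.
exact: is_derive_mulmx (is_derive_trmx hA) hB.
Qed.

(** Stated for any filter so that it applies to one-sided continuity at the
    initial time as well as to limits at infinity. *)
Lemma cvg_mxP T (F : set_system T) {FF : Filter F} m n (X : T -> 'M[K]_(m, n))
    (L : 'M[K]_(m, n)) :
  X x @[x --> F] --> L <-> forall i j, X x i j @[x --> F] --> L i j.
Proof.
split=> [XL i j|H].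
  exact: (cvg_comp _ _ XL (@coord_continuous K m n i j L)).
apply/cvgrPdist_le => e e0; near=> x.
apply: mx_norm_leP (ltW e0) _ => i j.
move: i j; near: x; apply: filter_forall => i; apply: filter_forall => j.
near=> x; rewrite !mxE; near: x.
exact: (cvgrPdist_le _ _).1 (H i j) _ e0.
Unshelve. all: by end_near. Qed.

Section CvgMatrix.
Context {T : Type} {F : set_system T} {FF : Filter F}.

Lemma cvg_mulmx m n p (A : T -> 'M[K]_(m, n)) (B : T -> 'M[K]_(n, p))
    (a : 'M[K]_(m, n)) (b : 'M[K]_(n, p)) :
  A x @[x --> F] --> a -> B x @[x --> F] --> b ->
  (A x *m B x) @[x --> F] --> a *m b.
Proof.
move=> /cvg_mxP Aa /cvg_mxP Bb; apply/cvg_mxP => i j; rewrite mxE.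
under eq_cvg do rewrite mxE.
by apply: cvg_big => [|k _]; [exact: add_continuous | apply: cvgM].
Qed.

Lemma cvg_trmx m n (A : T -> 'M[K]_(m, n)) (a : 'M[K]_(m, n)) :
  A x @[x --> F] --> a -> (A x)^T @[x --> F] --> a^T.
Proof.
move=> /cvg_mxP Aa; apply/cvg_mxP => i j; rewrite mxE.
by under eq_cvg do rewrite mxE; apply: Aa.
Qed.

Lemma cvg_vee (A : T -> 'M[K]_3) (a : 'M[K]_3) :
  A x @[x --> F] --> a -> vee (A x) @[x --> F] --> vee a.
Proof.
move=> /cvg_mxP Aa; apply/cvg_mxP => i j.
rewrite mxE; case: i => -[|[|[|//]]] Hi /=;
  by under eq_cvg do rewrite mxE /=; apply: Aa.
Qed.

Lemma cvg_mxtrace n (A : T -> 'M[K]_n) (a : 'M[K]_n) :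
  A x @[x --> F] --> a -> \tr (A x) @[x --> F] --> \tr a.
Proof. by move=> /cvg_mxP Aa; apply: cvg_big => [|k _]; [exact: add_continuous|]. Qed.

Lemma cvg_ip m n (A B : T -> 'M[K]_(m, n)) (a b : 'M[K]_(m, n)) :
  A x @[x --> F] --> a -> B x @[x --> F] --> b ->
  ip (A x) (B x) @[x --> F] --> ip a b.
Proof. by move=> Aa Bb; apply/cvg_mxtrace/cvg_mulmx => //; apply: cvg_trmx. Qed.

End CvgMatrix.

End MatrixCalculus.

Section Barbalat.
Context {K : realType}.
Implicit Types (f df V dV : K -> K).

Lemma mean_value f df (a b : K) : a < b ->
    (forall t, a <= t <= b -> is_derive t (1 : K) f (df t)) ->
  exists2 t, a < t < b & f b - f a = df t * (b - a).
Proof.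
move=> ab fdf; have [t|t|t] := @MVT K f df a b ab.
- by rewrite in_itv /= => /andP[/ltW ? /ltW ?]; apply: fdf; apply/andP.
- apply: derivable_within_continuous => s; rewrite in_itv /= => /fdf.
  by case.
- by rewrite in_itv /=; exists t.
Qed.

(** Once [V] is within [d] of its infimum it cannot drop by [d] any more.  But if
    [|f t| >= e] then [|f| >= e / 2] on an interval of length [h] on which [f]
    cannot change by more than [e / 2], and there [V] drops by
    [d = mu (e / 2)^2 h]. *)
Lemma barbalat V dV f df (t1 mu L : K) : 0 < mu ->
    (forall t, t1 < t -> 0 <= V t) ->
    (forall t, t1 < t -> is_derive t (1 : K) V (dV t)) ->
    (forall t, t1 < t -> dV t <= - (mu * f t ^+ 2)) ->
    (forall t, t1 < t -> is_derive t (1 : K) f (df t)) ->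
    (forall t, t1 < t -> `|df t| <= L) ->
  f t @[t --> +oo] --> (0 : K).
Proof.
move=> mu0 V0 VdV dVf fdf dfL.
have L0 : 0 <= L by apply: le_trans (dfL (t1 + 1) _); rewrite ?ltrDl.
have V_le a b : t1 < a -> a <= b -> V b <= V a.
  move=> ta; rewrite le_eqVlt => /orP[/eqP->//|ab].
  have [t ht|t /andP[at_ tb] e] := @mean_value V dV a b ab.
    by apply: VdV; case/andP: ht => + _; apply: lt_le_trans.
  rewrite -subr_le0 e mulr_le0_ge0 ?subr_ge0 ?(ltW ab) //.
  rewrite (le_trans (dVf _ (lt_trans ta at_))) // oppr_le0.
  by rewrite mulr_ge0 ?sqr_ge0 // ltW.
apply/cvgr0Pnorm_lt => e e0.
(* L + 1 rather than L, which may be zero *)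
pose h := e / (2 * (L + 1)).
have L1 : 0 < L + 1 by rewrite ltr_wpDl.
have h0 : 0 < h by rewrite divr_gt0 // mulr_gt0.
have Lh : (L + 1) * h = e / 2 by rewrite /h; field; rewrite gt_eqF.
pose d := mu * (e / 2) ^+ 2 * h.
have d0 : 0 < d.
  by apply: mulr_gt0 h0; apply: mulr_gt0 mu0 _; rewrite exprn_gt0 ?divr_gt0.
pose S := [set V t | t in [set t | t1 < t]].
have S0 : has_inf S.
  split; first by exists (V (t1 + 1)), (t1 + 1) => //=; rewrite ltrDl.
  by exists 0 => _ [t tt <-]; apply: V0.
have [_ [t2 /= tt2 <-] Vt2] := inf_adherent d0 S0.
exists t2; split; first exact: num_real.
move=> t tt /=; rewrite real_ltNge ?num_real //; apply/negP => fe.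
have t1t : t1 < t by apply: lt_trans tt.
have f_ge s : t <= s <= t + h -> e / 2 <= `|f s|.
  move=> /andP[]; rewrite le_eqVlt => /orP[/eqP <- _|ts sth].
    by rewrite (le_trans _ fe) // ler_pdivrMr // ler_pMr //; lra.
  have [u hu|u /andP[tu _] eu] := @mean_value f df t s ts.
    by apply: fdf; case/andP: hu => + _; apply: lt_le_trans.
  have dist : `|f s - f t| <= e / 2.
    rewrite eu normrM -Lh ler_pM //.
      by rewrite (le_trans (dfL _ (lt_trans t1t tu))) // lerDl.
    by rewrite gtr0_norm ?subr_gt0 // lerBlDl.
  have := ler_normB (f s) (f s - f t); rewrite subKr; lra.
have th : t < t + h by rewrite ltrDl.
have [u hu|u /andP[tu uth] eu] := @mean_value V dV t (t + h) th.
  by apply: VdV; case/andP: hu => + _; apply: lt_le_trans.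
have Vdrop : V (t + h) - V t <= - d.
  rewrite eu /d addrAC subrr add0r -mulNr ler_pM2r //.
  rewrite (le_trans (dVf _ (lt_trans t1t tu))) // lerN2 ler_pM2l //.
  rewrite -[leRHS]real_normK ?num_real // lerXn2r ?nnegrE ?divr_ge0 ?(ltW e0) //.
  by apply: f_ge; rewrite !ltW.
have := V_le _ _ tt2 (ltW tt).
have : inf S <= V (t + h).
  by apply: ge_inf; [case: S0|exists (t + h) => //=; apply: lt_trans th].
lra.
Qed.

End Barbalat.

(** * Derivatives of the errors along a trajectory *)

Section ErrorCalculus.
Context {K : realType} (J : 'M[K]_3) (g1 g2 g3 kR kOm kJ c : K).
Local Notation G := (diag3 g1 g2 g3).
Local Notation V := (lyapunov J g1 g2 g3 kR kJ c).

Lemma tr_diag_mx3 : G^T = G.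
Proof. by rewrite /diag3 tr_diag_mx. Qed.

Lemma is_derive_attitude_error (A : 'M[K]_3) (E : K -> 'M[K]_3) t dE :
  is_derive t (1 : K) E dE ->
  is_derive t (1 : K) (fun s => attitude_error A (E s)) (attitude_error A dE).
Proof.
move=> hE; rewrite /attitude_error.
have hA := is_derive_cst A t (1 : K).
have h1 := is_derive_mulmx hA hE.
have h2 := is_derive_mulmx (is_derive_trmx hE) hA.
rewrite mul0mx add0r in h1; rewrite mulmx0 addr0 in h2.
exact: is_deriveZ (is_derive_vee (is_deriveB h1 h2)).
Qed.

Lemma is_derive_navigation (A : 'M[K]_3) (E : K -> 'M[K]_3) t dE :
  is_derive t (1 : K) E dE ->
  is_derive t (1 : K) (fun s => navigation A (E s)) (- (2^-1 * \tr (A *m dE))).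
Proof.
move=> hE; rewrite /navigation.
have hA := is_derive_cst A t (1 : K).
have h1 := is_derive_mulmx hA (is_deriveB (is_derive_cst (1%:M : 'M[K]_3) t (1 : K)) hE).
rewrite mul0mx !add0r in h1.
apply: (is_derive_eq (is_deriveZ _ (is_derive_mxtrace h1))).
by rewrite /GRing.scale /= mulmxN raddfN /= mulrN.
Qed.

Lemma is_derive_quadratic (A : 'M[K]_3) (x : K -> 'cV[K]_3) t dx : A^T = A ->
  is_derive t (1 : K) x dx ->
  is_derive t (1 : K) (fun s => ip (x s) (A *m x s)) (2 * ip (x t) (A *m dx)).
Proof.
move=> As hx; have h := is_derive_mulmx (is_derive_cst A t (1 : K)) hx.
rewrite mul0mx add0r in h.
apply: (is_derive_eq (is_derive_ip hx h)).
by rewrite [ip dx _]ipC ip_mull As mulr2n mulrDl mul1r.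
Qed.

Lemma is_derive_lyapunov (E P : K -> 'M[K]_3) (e : K -> 'cV[K]_3) t de dP :
    J^T = J -> is_derive t (1 : K) E (E t *m hat (e t)) ->
    is_derive t (1 : K) e de -> is_derive t (1 : K) P dP ->
  let eR := attitude_error G (E t) in
  let deR := attitude_rate G (E t) *m e t in
  is_derive t (1 : K) (fun s => V (E s) (e s) (P s))
    (ip (e t + c *: eR) (J *m (de + c *: deR)) - c ^+ 2 * ip eR (J *m deR)
     + kR * ip eR (e t) + kJ^-1 * ip (P t) dP).
Proof.
move=> Js hE he hP eR deR.
have hR := is_derive_attitude_error G hE.
rewrite attitude_error_hat ?tr_diag_mx3 // -/deR in hR.
have hN := is_derive_navigation G hE.
rewrite navigation_hat ?tr_diag_mx3 // mulrN opprK mulKf // -/eR in hN.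
have hA := is_derive_quadratic Js (is_deriveD he (is_deriveZ c hR)).
have hJR := is_derive_quadratic Js hR.
have hPP := is_derive_ip hP hP.
rewrite /lyapunov.
apply: (is_derive_eq (is_deriveD (is_deriveD (is_deriveB
  (is_deriveZ 2^-1 hA) (is_deriveZ (c ^+ 2 / 2) hJR)) (is_deriveZ kR hN))
  (is_deriveZ (2 * kJ)^-1 hPP))).
rewrite /GRing.scale /= [ip dP _]ipC invfM -/eR; lra.
Qed.

Lemma cvg_lyapunov T (F : set_system T) {FF : Filter F} (E P : T -> 'M[K]_3)
    (e : T -> 'cV[K]_3) (E0 P0 : 'M[K]_3) (e0 : 'cV[K]_3) :
  E x @[x --> F] --> E0 -> e x @[x --> F] --> e0 -> P x @[x --> F] --> P0 ->
  V (E x) (e x) (P x) @[x --> F] --> V E0 e0 P0.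
Proof.
move=> hE he hP; rewrite /lyapunov.
have hR : attitude_error G (E x) @[x --> F] --> attitude_error G E0.
  rewrite /attitude_error; apply: cvgZr; apply: cvg_vee; apply: cvgB.
    by apply: cvg_mulmx hE; exact: cvg_cst.
  by apply: cvg_mulmx; [exact: cvg_trmx | exact: cvg_cst].
have hA : e x + c *: attitude_error G (E x) @[x --> F] -->
    e0 + c *: attitude_error G E0 by exact: cvgD he (cvgZr hR).
have hJ (x : T -> 'cV[K]_3) x0 : x y @[y --> F] --> x0 ->
    J *m x y @[y --> F] --> J *m x0.
  by move=> hx; apply: cvg_mulmx hx; exact: cvg_cst.
apply: cvgD; last exact: cvgMr (cvg_ip hP hP).
apply: cvgD; last first.
  rewrite /navigation; do 2 apply: cvgMr; apply: cvg_mxtrace.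
  by apply: cvg_mulmx; [exact: cvg_cst | apply: cvgB hE; exact: cvg_cst].
by apply: cvgB; apply: cvgMr; apply: cvg_ip => //; apply: hJ.
Qed.

End ErrorCalculus.

Section Trajectory.
Context {K : realType} (J : 'M[K]_3) (g1 g2 g3 kR kOm kJ c : K).
Local Notation G := (diag3 g1 g2 g3).
Context (Rd : K -> 'M[K]_3) (Omd : K -> 'cV[K]_3).
Hypothesis command : attitude_command Rd Omd.

Lemma command_derivable t : derivable Rd t 1.
Proof. by case: command => _ /(_ 0 t). Qed.

(** The angular velocity of the command is recovered from its derivative, hence
    inherits its smoothness. *)
Lemma command_velocityE : Omd = fun t => vee ((Rd t)^T *m derive1 Rd t).
Proof.
case: command => SRd _ dRd; apply/funext => t.
by case: (SRd t) => RR _; rewrite dRd mulmxA RR mul1mx hatK.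
Qed.

Lemma command_velocity_derivable t : derivable Omd t 1.
Proof.
have d1 : derivable (derive1 Rd) t 1 by case: command => _ /(_ 1 t).
rewrite command_velocityE.
have [] // := is_derive_vee (is_derive_mulmx
  (is_derive_trmx (is_derive_derive1 (@command_derivable t)))
  (is_derive_derive1 d1)).
Qed.

Context (t0 : K) (T : \bar K) (R : K -> 'M[K]_3) (Om : K -> 'cV[K]_3)
  (Jbar : K -> 'M[K]_3).
Hypothesis loop : closed_loop J kR kOm kJ c G Rd Omd t0 T R Om Jbar.

Let E t := (Rd t)^T *m R t.
Let e t := e_Om (R t) (Rd t) (Om t) (Omd t).
Let P t := J - Jbar t.
Let al t := alpha_d (R t) (Rd t) (Om t) (Omd t) (derive1 Omd t).

Lemma trajectory_SO3 t : time_span t0 T t -> SO3 (E t).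
Proof.
case: command => SRd _ _ tT; apply: SO3_trmul => //.
by case: loop => _ _ _ /(_ t tT)[].
Qed.

(** The velocity of the command enters on the left of [E]; moving it to the right
    rotates it into the body frame. *)
Lemma is_derive_relative_attitude t : t0 < t -> (t%:E < T)%E ->
  is_derive t (1 : K) E (E t *m hat (e t)).
Proof.
move=> t0t tT; case: loop => _ _ _ _ /(_ t t0t tT)[dR _ _ [_ R' _]].
have SE : SO3 (E t) by apply: trajectory_SO3; split => //; apply: ltW.
case: command => _ _ /(_ t) Rd'.
have hR := is_derive_derive1 dR; rewrite R' in hR.
have hRd := is_derive_derive1 (@command_derivable t); rewrite Rd' in hRd.
apply: (is_derive_eq (is_derive_mulmx (is_derive_trmx hRd) hR)).
rewrite trmx_mul tr_hat !mulNmx -!mulmxA -/(E t) hat_SO3_mul //.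
rewrite !mulmxA -/(E t) addrC -mulmxBr; congr (_ *m _).
rewrite /e /e_Om [(E t)^T]trmx_mul trmxK.
move: (_ *m Omd t) => x.
by apply: matrix3P; split; rewrite !mxE /=; ring.
Qed.

Lemma is_derive_velocity_error t : t0 < t -> (t%:E < T)%E ->
  is_derive t (1 : K) e (derive1 Om t - al t).
Proof.
move=> t0t tT; case: loop => _ _ _ _ /(_ t t0t tT)[dR dOm _ [_ R' _]].
case: command => _ _ /(_ t) Rd'.
have hR := is_derive_derive1 dR; rewrite R' in hR.
have hRd := is_derive_derive1 (@command_derivable t); rewrite Rd' in hRd.
have hOmd := is_derive_derive1 (@command_velocity_derivable t).
rewrite /e /e_Om.
apply: (is_derive_eq (is_deriveB (is_derive_derive1 dOm)
  (is_derive_mulmx (is_derive_mulmx (is_derive_trmx hR) hRd) hOmd))).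
congr (_ - _); rewrite /al /alpha_d trmx_mul tr_hat !mulNmx mulmxDl !mulNmx.
rewrite -[_ *m (Rd t *m _) *m _]mulmxA -[Rd t *m _ *m _]mulmxA hat_mul.
suff -> : cross (Omd t) (Omd t) = 0 by rewrite !mulmx0 addr0.
by apply/colP => i; rewrite !mxE; case: i => -[|[|[|//]]] ? /=; ring.
Qed.

Lemma is_derive_inertia_error t : t0 < t -> (t%:E < T)%E ->
  is_derive t (1 : K) P (- derive1 Jbar t).
Proof.
move=> t0t tT; case: loop => _ _ _ _ /(_ t t0t tT)[_ _ dJ _].
apply: (is_derive_eq (is_deriveB (is_derive_cst J t 1) (is_derive_derive1 dJ))).
by rewrite sub0r.
Qed.

(** The terms of the control law built on the estimate compensate the inertial
    terms up to the estimation error [P]. *)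
Lemma velocity_error_dynamics t : t0 < t -> (t%:E < T)%E ->
  J *m (derive1 Om t - al t) = - (kR *: attitude_error G (E t)) - kOm *: e t
    - cross (Om t) (P t *m Om t) - P t *m al t.
Proof.
move=> t0t tT; case: loop => _ _ _ _ /(_ t t0t tT)[_ _ _ [JOm _ _]].
move: JOm => /(canRL (addrK _)) JOm.
rewrite mulmxBr JOm /control e_RE -/(E t) -/(e t) -/(al t) /P !mulmxBl.
rewrite -!hat_mul mulmxBr.
move: (hat (Om t) *m _) (hat (Om t) *m (Jbar t *m _)) => x y.
move: (J *m al t) (Jbar t *m al t) (kR *: _) (kOm *: _) => z w u v.
by apply/colP => i; rewrite !mxE; ring.
Qed.

End Trajectory.

(** * Stability, boundedness and convergence *)

Section BoundedFamilies.
Context {K : realType} (D : set K).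

(** Boundedness is handled without explicit constants: the derivative of the
    velocity error is assembled from many bounded signals. *)
Definition bounded_on m n (X : K -> 'M[K]_(m, n)) : Prop :=
  exists b : K, forall t, D t -> `|X t| <= b.

Lemma bounded_onD m n (X Y : K -> 'M[K]_(m, n)) :
  bounded_on X -> bounded_on Y -> bounded_on (fun t => X t + Y t).
Proof.
move=> [a Xa] [b Yb]; exists (a + b) => t Dt.
by rewrite (le_trans (ler_normD _ _)) // lerD ?Xa ?Yb.
Qed.

Lemma bounded_onN m n (X : K -> 'M[K]_(m, n)) :
  bounded_on X -> bounded_on (fun t => - X t).
Proof. by move=> [a Xa]; exists a => t Dt; rewrite normrN Xa. Qed.

Lemma bounded_onZ k m n (X : K -> 'M[K]_(m, n)) :
  bounded_on X -> bounded_on (fun t => k *: X t).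
Proof.
by move=> [a Xa]; exists (`|k| * a) => t Dt; rewrite normrZ ler_wpM2l ?Xa.
Qed.

Lemma bounded_on_tr m n (X : K -> 'M[K]_(m, n)) :
  bounded_on X -> bounded_on (fun t => (X t)^T).
Proof.
move=> [a Xa]; exists a => t Dt; apply: mx_norm_leP => [|i j].
  by rewrite (le_trans _ (Xa t Dt)).
by rewrite mxE (le_trans (normr_entry_le _ _ _)) ?Xa.
Qed.

Lemma bounded_onM m n p (X : K -> 'M[K]_(m, n)) (Y : K -> 'M[K]_(n, p)) :
  bounded_on X -> bounded_on Y -> bounded_on (fun t => X t *m Y t).
Proof.
move=> [a Xa] [b Yb]; exists (n%:R * (a * b)) => t Dt.
have a0 : 0 <= a by rewrite (le_trans _ (Xa t Dt)).
have b0 : 0 <= b by rewrite (le_trans _ (Yb t Dt)).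
apply: mx_norm_leP => [|i j]; first by rewrite !mulr_ge0.
rewrite mxE (le_trans (ler_norm_sum _ _ _)) //.
rewrite (le_trans (y := \sum_(k < n) a * b)) //.
  apply: ler_sum => k _; rewrite normrM ler_pM //.
    exact: le_trans (normr_entry_le _ _ _) (Xa t Dt).
  exact: le_trans (normr_entry_le _ _ _) (Yb t Dt).
by rewrite sumr_const card_ord mulr_natl.
Qed.

Lemma bounded_on_hat (X : K -> 'cV[K]_3) :
  bounded_on X -> bounded_on (fun t => hat (X t)).
Proof.
move=> [a Xa]; exists a => t Dt.
have a0 : 0 <= a by rewrite (le_trans _ (Xa t Dt)).
have Xe i : `|X t i 0| <= a by rewrite (le_trans (normr_entry_le _ _ _)) ?Xa.
apply: mx_norm_leP => // i j; rewrite mxE.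
case: i => -[|[|[|//]]] ? /=; case: j => -[|[|[|//]]] ? /=;
  by rewrite ?normrN ?normr0 ?Xe.
Qed.

Lemma bounded_on_ip m n (X : K -> 'M[K]_(m, n)) a :
  (forall t, D t -> ip (X t) (X t) <= a) -> bounded_on X.
Proof. by move=> Xa; exists (Num.sqrt a) => t Dt; rewrite mx_norm_le_sqrt ?Xa. Qed.

Lemma bounded_on_cst m n (A : 'M[K]_(m, n)) : bounded_on (fun=> A).
Proof. by exists `|A|. Qed.

Lemma bounded_on_SO3 (X : K -> 'M[K]_3) :
  (forall t, D t -> SO3 (X t)) -> bounded_on X.
Proof.
move=> SX; apply: (@bounded_on_ip _ _ _ 3) => t /SX[XX _].
by rewrite /ip XX mxtrace1.
Qed.

End BoundedFamilies.

Lemma time_span_start (K : realType) (t0 t : K) T :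
  time_span t0 T t -> time_span t0 T t0.
Proof. by case=> t0t tT; split => //; apply: le_lt_trans tT; rewrite lee_fin. Qed.

Section LyapunovAnalysis.
Context {K : realType} (J : 'M[K]_3) (lm lM g1 g2 g3 kR kOm kJ c : K).
Context (Rd : K -> 'M[K]_3) (Omd : K -> 'cV[K]_3).
Local Notation G := (diag3 g1 g2 g3).
Local Notation trajectory := (closed_loop J kR kOm kJ c G Rd Omd).
Hypothesis J_sym : J^T = J.
Hypotheses (lm_gt0 : 0 < lm) (lm_lM : lm <= lM).
Hypothesis J_ge : forall x : 'cV[K]_3, lm * ip x x <= ip x (J *m x).
Hypothesis J_le : forall x : 'cV[K]_3, ip x (J *m x) <= lM * ip x x.
Hypotheses (g1_gt0 : 0 < g1) (g2_gt0 : 0 < g2) (g3_gt0 : 0 < g3).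
Hypotheses (kR_gt0 : 0 < kR) (kOm_gt0 : 0 < kOm) (kJ_gt0 : 0 < kJ).
Hypothesis c_gt0 : 0 < c.
Hypothesis command : attitude_command Rd Omd.
Hypothesis c_pos : c ^+ 2 * lM ^+ 2 < 2 * b1 g1 g2 g3 * kR * lm.
Hypothesis c_diss :
  c * (kOm ^+ 2 + 2 * Num.sqrt 2 * kR * lM * \tr G) < 4 * kR * kOm.

Definition storage (R : K -> 'M[K]_3) (Om : K -> 'cV[K]_3) (Jbar : K -> 'M[K]_3)
    (t : K) : K :=
  lyapunov J g1 g2 g3 kR kJ c ((Rd t)^T *m R t)
    (e_Om (R t) (Rd t) (Om t) (Omd t)) (J - Jbar t).

Lemma storage_rate : exists2 mu, 0 < mu &
  forall t0 T R Om Jbar, trajectory t0 T R Om Jbar ->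
  forall t, t0 < t -> (t%:E < T)%E ->
    derivable (storage R Om Jbar) t 1 /\
    derive1 (storage R Om Jbar) t <=
      - (mu * (ip (e_Om (R t) (Rd t) (Om t) (Omd t))
                  (e_Om (R t) (Rd t) (Om t) (Omd t))
             + ip (e_R G (R t) (Rd t)) (e_R G (R t) (Rd t)))).
Proof.
have [mu mu0 diss] := lyapunov_dissipation g1_gt0 g2_gt0 g3_gt0 kR_gt0 kOm_gt0
  c_gt0 lm_gt0 lm_lM J_sym J_ge J_le c_diss.
exists mu => // t0 T R Om Jbar loop t t0t tT.
have SE := trajectory_SO3 command loop (conj (ltW t0t) tT).
have [_ _ _ SJ ode] := loop.
have [_ Js] := SJ t (conj (ltW t0t) tT).
have [_ _ _ [_ _ Jdot]] := ode t t0t tT.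
have := is_derive_lyapunov g1 g2 g3 kR kJ c J_sym
  (is_derive_relative_attitude command loop t0t tT)
  (is_derive_velocity_error command loop t0t tT)
  (is_derive_inertia_error loop t0t tT).
have Ps : (J - Jbar t)^T = J - Jbar t by rewrite raddfB /= J_sym Js.
have balance := lyapunov_balance c J_sym Ps (lt0r_neq0 kJ_gt0)
  (velocity_error_dynamics loop t0t tT).
rewrite Jdot /update_law /e_A !e_RE balance.
move=> [dV dVE]; split; first exact: dV.
by rewrite derive1E [leLHS]dVE; apply: diss.
Qed.

Lemma storage_continuous t0 T R Om Jbar : trajectory t0 T R Om Jbar ->
  {within time_span t0 T, continuous (storage R Om Jbar)}.
Proof.
move=> [cR cOm cJ _ _] t.
have cRd : {within time_span t0 T, continuous Rd}.
  apply: continuous_subspaceT => s; apply: differentiable_continuous.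
  exact/derivable1_diffP/(@command_derivable _ _ _ command).
have cOmd : {within time_span t0 T, continuous Omd}.
  apply: continuous_subspaceT => s; apply: differentiable_continuous.
  exact/derivable1_diffP/(@command_velocity_derivable _ _ _ command).
apply: cvg_lyapunov.
- by apply: cvg_mulmx; [apply: cvg_trmx; apply: cRd | apply: cR].
- apply: cvgB; first exact: cOm.
  apply: cvg_mulmx; last exact: cOmd.
  by apply: cvg_mulmx; [apply: cvg_trmx; apply: cR | apply: cRd].
- by apply: cvgB; [exact: cvg_cst | apply: cJ].
Qed.

Lemma storage_nonincreasing t0 T R Om Jbar : trajectory t0 T R Om Jbar ->
  forall t, time_span t0 T t -> storage R Om Jbar t <= storage R Om Jbar t0.
Proof.
move=> loop t [t0t tT]; have [mu mu0 rate] := storage_rate.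
have inside s : s \in `]t0, t[ -> t0 < s /\ (s%:E < T)%E.
  rewrite in_itv /= => /andP[t0s st]; split => //.
  by apply: le_lt_trans tT; rewrite lee_fin ltW.
apply: (@ler0_derive1_le_cc _ (storage R Om Jbar) t0 t) => //.
- by move=> s /inside[t0s sT]; case: (rate _ _ _ _ _ loop s t0s sT).
- move=> s /inside[t0s sT]; have [_ le] := rate _ _ _ _ _ loop s t0s sT.
  rewrite (le_trans le) // oppr_le0 mulr_ge0 ?(ltW mu0) //.
  by rewrite addr_ge0 ?ip_ge0.
- apply: continuous_subspaceW (storage_continuous loop) => s /=.
  rewrite in_itv /= => /andP[t0s st]; split => //.
  by apply: le_lt_trans tT; rewrite lee_fin.
- by rewrite in_itv /= lexx t0t.
- by rewrite in_itv /= lexx t0t.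
Qed.

(** The attitude is measured by [Psi], which is comparable both to [|R - Rd|^2]
    and to its share in the storage function. *)
Definition error_size (R : K -> 'M[K]_3) (Om : K -> 'cV[K]_3)
    (Jbar : K -> 'M[K]_3) (t : K) : K :=
  ip (e_Om (R t) (Rd t) (Om t) (Omd t)) (e_Om (R t) (Rd t) (Om t) (Omd t))
  + navigation G ((Rd t)^T *m R t) + ip (J - Jbar t) (J - Jbar t).

(** One constant for all trajectories and all initial times: stability uses it
    for small initial errors, boundedness for arbitrary ones. *)
Lemma errors_le_initial : exists2 N, 0 < N &
  forall t0 T R Om Jbar, trajectory t0 T R Om Jbar ->
  forall t, time_span t0 T t ->
    [/\ ip (R t - Rd t) (R t - Rd t) <= N * error_size R Om Jbar t0,
        ip (e_R G (R t) (Rd t)) (e_R G (R t) (Rd t))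
          <= N * error_size R Om Jbar t0,
        ip (e_Om (R t) (Rd t) (Om t) (Omd t)) (e_Om (R t) (Rd t) (Om t) (Omd t))
          <= N * error_size R Om Jbar t0 &
        ip (J - Jbar t) (J - Jbar t) <= N * error_size R Om Jbar t0].
Proof.
have b0 := b1_gt0 g1_gt0 g2_gt0 g3_gt0.
have [m m0 low] := lyapunov_lower g1_gt0 g2_gt0 g3_gt0 kR_gt0 kJ_gt0
  c_gt0 lm_gt0 lm_lM J_ge J_le c_pos.
have [M M0 upp] := lyapunov_upper g1_gt0 g2_gt0 g3_gt0 kR_gt0 kJ_gt0
  c_gt0 lm_gt0 lm_lM J_ge J_le.
pose gm := Num.min (Num.min g1 g2) g3 / 4.
have gm0 : 0 < gm by rewrite divr_gt0 // !lt_min g1_gt0 g2_gt0.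
pose q := 1 + gm^-1 + (b1 g1 g2 g3)^-1.
have q_ge x : 0 <= x -> [/\ x <= q * x, gm^-1 * x <= q * x
    & (b1 g1 g2 g3)^-1 * x <= q * x].
  move=> x0; have ? : 0 <= gm^-1 * x by rewrite mulr_ge0 // invr_ge0 ltW.
  have ? : 0 <= (b1 g1 g2 g3)^-1 * x by rewrite mulr_ge0 // invr_ge0 ltW.
  by rewrite /q; split; lra.
have q0 : 0 < q by rewrite !addr_gt0 // invr_gt0.
exists (q * (M / m)); first by rewrite mulr_gt0 // divr_gt0.
move=> t0 T R Om Jbar loop t tT.
have t0T := time_span_start tT.
have SE := trajectory_SO3 command loop tT.
have SE0 := trajectory_SO3 command loop t0T.
set W0 := error_size R Om Jbar t0.
have W_le : error_size R Om Jbar t <= M / m * W0.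
  rewrite mulrAC ler_pdivlMr // mulrC (le_trans (low _ _ _ SE)) //.
  apply: le_trans (storage_nonincreasing loop tT) _.
  exact: upp.
have N0 := navigation_ge0 g1_gt0 g2_gt0 g3_gt0 SE.
have parts : [/\ navigation G ((Rd t)^T *m R t) <= M / m * W0,
    ip (e_Om (R t) (Rd t) (Om t) (Omd t)) (e_Om (R t) (Rd t) (Om t) (Omd t))
      <= M / m * W0 &
    ip (J - Jbar t) (J - Jbar t) <= M / m * W0].
  move: W_le; rewrite /error_size.
  have := ip_ge0 (e_Om (R t) (Rd t) (Om t) (Omd t)).
  have := ip_ge0 (J - Jbar t).
  by move=> ? ? ?; split; lra.
case: parts => Nle ele Ple.
have W0' : 0 <= M / m * W0 by apply: le_trans Ple; exact: ip_ge0.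
have [q1 q2 q3] := q_ge _ W0'; rewrite -mulrA.
split; [|rewrite e_RE| |].
- have SRd : SO3 (Rd t) by case: command.
  apply: le_trans q2; rewrite ler_pdivlMl // ip_sub_SO3 //.
  by apply: le_trans Nle; apply: navigation_ge_dist.
- apply: le_trans q3.
  apply: (le_trans (ip_attitude_error_le g1_gt0 g2_gt0 g3_gt0 SE)).
  by rewrite ler_wpM2l // invr_ge0 ltW.
- exact: le_trans q1.
- exact: le_trans q1.
Qed.

Lemma stable : zero_errors_stable J kR kOm kJ c G Rd Omd.
Proof.
move=> t0 eps eps0; have [N N0 bnd] := errors_le_initial.
(* numbers of entries, 3 + 9 in e and P and 9 in R - Rd: the squared Frobenius
   norm is at most that many times the square of the maximum norm *)
pose q := 12 + \tr G / 4 * 9.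
have tG : 0 < \tr G by rewrite tr_diag3 !addr_gt0.
have q0 : 0 < q by rewrite addr_gt0 // mulr_gt0 // divr_gt0.
pose L := N * q; have L0 : 0 < L by rewrite mulr_gt0.
(* L delta^2 < eps^2 without a square root, as L < (1 + L)^2 *)
pose delta := eps / (1 + L).
have L1 : 0 < 1 + L by rewrite addr_gt0.
have delta0 : 0 < delta by rewrite divr_gt0.
have L_delta : L * delta ^+ 2 < eps ^+ 2.
  have -> : eps = delta * (1 + L) by rewrite divfK ?gt_eqF.
  clearbody delta.
  rewrite exprMn [ltLHS]mulrC ltr_pM2l ?exprn_gt0 //.
  by have := sqr_ge0 L; nra.
exists delta => // T R Om Jbar loop hR he hJ t tT.
have t0T := time_span_start tT.
have SE0 := trajectory_SO3 command loop t0T.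
have small m n (A : 'M[K]_(m, n)) : `|A| < delta -> ip A A <= (m * n)%:R * delta ^+ 2.
  move=> Ad; rewrite (le_trans (ip_le_mx_norm A)) // ler_wpM2l //.
  by rewrite lerXn2r ?nnegrE // ltW.
have W0 : N * error_size R Om Jbar t0 < eps ^+ 2.
  apply: le_lt_trans L_delta; rewrite /L -mulrA ler_pM2l //.
  have := small _ _ _ he; have := small _ _ _ hJ; have := small _ _ _ hR.
  have SRd : SO3 (Rd t0) by case: command.
  rewrite ip_sub_SO3 // => h1 h2 h3.
  have h4 := navigation_le g1_gt0 g2_gt0 g3_gt0 SE0.
  have h5 := ler_wpM2l (ltW (divr_gt0 tG (ltr0Sn K 3))) h1.
  rewrite /error_size /q; move: h2 h3 h4 h5; rewrite !natrM; lra.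
have to_norm m n (A : 'M[K]_(m, n)) :
    ip A A <= N * error_size R Om Jbar t0 -> `|A| < eps.
  move=> AN; apply: le_lt_trans (mx_norm_le_sqrt AN) _.
  rewrite -[ltRHS]gtr0_norm // -sqrtr_sqr ltr_sqrt ?exprn_gt0 //.
by case: (bnd _ _ _ _ _ loop t tT) => *; split; apply: to_norm.
Qed.

Lemma uniformly_bounded : errors_uniformly_bounded J kR kOm kJ c G Rd Omd.
Proof.
move=> a; have [N N0 bnd] := errors_le_initial.
have tG : 0 < \tr G by rewrite tr_diag3 !addr_gt0.
exists (Num.sqrt (N * (12 * a ^+ 2 + 3 * \tr G))).
move=> t0 T R Om Jbar loop hR he hJ t tT.
have t0T := time_span_start tT.
have SE0 := trajectory_SO3 command loop t0T.
have small m n (A : 'M[K]_(m, n)) : `|A| <= a -> ip A A <= (m * n)%:R * a ^+ 2.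
  move=> Aa; rewrite (le_trans (ip_le_mx_norm A)) // ler_wpM2l //.
  by rewrite lerXn2r ?nnegrE // (le_trans _ Aa).
have W0 : error_size R Om Jbar t0 <= 12 * a ^+ 2 + 3 * \tr G.
  have := small _ _ _ he; have := small _ _ _ hJ.
  have h4 := navigation_le g1_gt0 g2_gt0 g3_gt0 SE0.
  (* Psi is half a weighted sum of defects, each at most 2 *)
  have d_le i : angle_defect ((Rd t0)^T *m R t0) i <= 2.
    by have := SO3_diag_le1 i SE0; rewrite ler_norml /angle_defect; lra.
  have h5 : \tr G / 4 * ip (1%:M - (Rd t0)^T *m R t0) (1%:M - (Rd t0)^T *m R t0)
      <= \tr G / 4 * 12.
    rewrite ler_pM2l ?divr_gt0 // ip_one_sub_SO3 //.
    by have := d_le 0; have := d_le 1; have := d_le 2; lra.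
  move: h4 h5; rewrite /error_size !natrM; lra.
have to_norm m n (A : 'M[K]_(m, n)) : ip A A <= N * error_size R Om Jbar t0 ->
    `|A| <= Num.sqrt (N * (12 * a ^+ 2 + 3 * \tr G)).
  by move=> AN; apply/mx_norm_le_sqrt/(le_trans AN); rewrite ler_pM2l.
by case: (bnd _ _ _ _ _ loop t tT) => *; split; apply: to_norm.
Qed.

Lemma storage_ge0 t0 T R Om Jbar : trajectory t0 T R Om Jbar ->
  forall t, time_span t0 T t -> 0 <= storage R Om Jbar t.
Proof.
move=> loop t tT; have SE := trajectory_SO3 command loop tT.
have [m m0 low] := lyapunov_lower g1_gt0 g2_gt0 g3_gt0 kR_gt0 kJ_gt0
  c_gt0 lm_gt0 lm_lM J_ge J_le c_pos.
apply: le_trans (low _ _ _ SE); rewrite mulr_ge0 ?(ltW m0) //.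
by rewrite !addr_ge0 ?ip_ge0 // navigation_ge0.
Qed.

(** Applies to both tracking errors, entry by entry; the storage function plays
    the role of the potential in [barbalat]. *)
Lemma dissipated_signal_converges t0 R Om Jbar (t1 : K)
    (x dx : K -> 'cV[K]_3) : trajectory t0 +oo%E R Om Jbar ->
    t0 <= t1 ->
    (forall t, ip (x t) (x t) <=
       ip (e_Om (R t) (Rd t) (Om t) (Omd t)) (e_Om (R t) (Rd t) (Om t) (Omd t))
       + ip (e_R G (R t) (Rd t)) (e_R G (R t) (Rd t))) ->
    (forall t, t1 < t -> is_derive t (1 : K) x (dx t)) ->
    bounded_on [set t | t1 < t] dx ->
  x t @[t --> +oo] --> (0 : 'cV[K]_3).
Proof.
move=> loop t01 x_le hx [L dxL]; have [mu mu0 rate] := storage_rate.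
apply/cvg_mxP => i j; rewrite mxE ord1.
apply: (@barbalat _ (storage R Om Jbar) (derive1 (storage R Om Jbar))
  (fun t => x t i 0) (fun t => dx t i 0) t1 mu L mu0).
- move=> t t1t; apply: (storage_ge0 loop); split; last exact: ltry.
  exact: ltW (le_lt_trans t01 t1t).
- move=> t t1t; have [dV _] := rate _ _ _ _ _ loop t (le_lt_trans t01 t1t) (ltry _).
  by rewrite derive1E; apply: derivableP.
- move=> t t1t; have [_ le] := rate _ _ _ _ _ loop t (le_lt_trans t01 t1t) (ltry _).
  rewrite (le_trans le) // lerN2 ler_pM2l // (le_trans _ (x_le t)) //.
  exact: sqr_entry_le_ip.
- by move=> t /hx /is_derive_mxP.
- by move=> t t1t; rewrite (le_trans (normr_entry_le _ _ _)) // dxL.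
Qed.

Lemma attitude_converges : attitude_error_converges J kR kOm kJ c G Rd Omd.
Proof.
move=> t0 R Om Jbar loop; have [N N0 bnd] := errors_le_initial.
have in_span t : t0 < t -> time_span t0 +oo%E t.
  by move=> t0t; split; [exact: ltW | exact: ltry].
apply: (@dissipated_signal_converges t0 R Om Jbar t0 _
  (fun t => attitude_rate G ((Rd t)^T *m R t) *m e_Om (R t) (Rd t) (Om t) (Omd t))
  loop (lexx _)).
- by move=> t; rewrite lerDr ip_ge0.
- move=> t t0t; under eq_fun do rewrite e_RE.
  have := is_derive_attitude_error G (is_derive_relative_attitude command loop t0t (ltry _)).
  by rewrite attitude_error_hat // tr_diag_mx3.
- apply: (@bounded_on_ip _ _ _ _ _
    ((\tr G) ^+ 2 / 2 * (N * error_size R Om Jbar t0))) => t /in_span ts.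
  have SE := trajectory_SO3 command loop ts.
  apply: (le_trans (attitude_rate_bound g1_gt0 g2_gt0 g3_gt0 _ SE)).
  rewrite ler_wpM2l ?divr_ge0 ?sqr_ge0 //.
  by case: (bnd _ _ _ _ _ loop t ts).
Qed.

Lemma J_unit : J \in unitmx.
Proof.
rewrite -row_free_unit -kermx_eq0; apply/rowV0P => u /sub_kermxP uJ.
apply: trmx_inj; rewrite trmx0; apply: ip_eq0.
have Ju : J *m u^T = 0 by rewrite -[J]J_sym -trmx_mul uJ trmx0.
apply/eqP; rewrite eq_le ip_ge0 andbT -(ler_pM2l lm_gt0) mulr0.
by rewrite (le_trans (J_ge _)) // Ju /ip mulmx0 mxtrace0.
Qed.

(** Boundedness of the command is needed to bound [alpha], hence [e']. *)
Lemma velocity_converges : bounded_command Omd ->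
  velocity_error_converges J kR kOm kJ c G Rd Omd.
Proof.
move=> [B hB] t0 R Om Jbar loop; have [N N0 bnd] := errors_le_initial.
pose t1 := Num.max t0 0; pose D := [set t | t1 < t].
have Dt t : D t -> [/\ time_span t0 +oo%E t, t0 < t & 0 <= t].
  rewrite /D /= /t1 gt_max => /andP[t0t t0']; split => //; last exact: ltW.
  by split; [exact: ltW | exact: ltry].
have [_ _ _ SJ _] := loop.
have bR : bounded_on D R.
  by apply: bounded_on_SO3 => t /Dt[ts _ _]; case: (SJ t ts).
have bRd : bounded_on D Rd by apply: bounded_on_SO3 => t _; case: command.
have bOmd : bounded_on D Omd.
  by exists B => t /Dt[_ _ t_ge0]; case: (hB t t_ge0).
have bdOmd : bounded_on D (derive1 Omd).
  by exists B => t /Dt[_ _ t_ge0]; case: (hB t t_ge0).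
have be : bounded_on D (fun t => e_Om (R t) (Rd t) (Om t) (Omd t)).
  apply: (@bounded_on_ip _ _ _ _ _ (N * error_size R Om Jbar t0)) => t /Dt[ts _ _].
  by case: (bnd _ _ _ _ _ loop t ts).
have beR : bounded_on D (fun t => e_R G (R t) (Rd t)).
  apply: (@bounded_on_ip _ _ _ _ _ (N * error_size R Om Jbar t0)) => t /Dt[ts _ _].
  by case: (bnd _ _ _ _ _ loop t ts).
have bP : bounded_on D (fun t => J - Jbar t).
  apply: (@bounded_on_ip _ _ _ _ _ (N * error_size R Om Jbar t0)) => t /Dt[ts _ _].
  by case: (bnd _ _ _ _ _ loop t ts).
have bRtRd : bounded_on D (fun t => (R t)^T *m Rd t).
  exact: bounded_onM (bounded_on_tr bR) bRd.
have bOm : bounded_on D Om.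
  rewrite (_ : Om = fun t => e_Om (R t) (Rd t) (Om t) (Omd t) + (R t)^T *m Rd t *m Omd t).
    exact: bounded_onD be (bounded_onM bRtRd bOmd).
  by apply/funext => t; rewrite subrK.
have bal : bounded_on D (fun t => alpha_d (R t) (Rd t) (Om t) (Omd t) (derive1 Omd t)).
  apply: bounded_onD; last exact: bounded_onM bRtRd bdOmd.
  apply: bounded_onN; apply: bounded_onM bOmd; apply: bounded_onM bRd.
  exact: bounded_onM (bounded_on_hat bOm) (bounded_on_tr bR).
pose de t := derive1 Om t - alpha_d (R t) (Rd t) (Om t) (Omd t) (derive1 Omd t).
apply: (@dissipated_signal_converges t0 R Om Jbar t1
  (fun t => e_Om (R t) (Rd t) (Om t) (Omd t)) de loop).
- by rewrite le_max lexx.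
- by move=> t; rewrite lerDl ip_ge0.
- by move=> t /Dt[_ t0t _]; exact: (is_derive_velocity_error command loop t0t (ltry _)).
pose Jde t := - (kR *: e_R G (R t) (Rd t)) - kOm *: e_Om (R t) (Rd t) (Om t) (Omd t)
  - hat (Om t) *m ((J - Jbar t) *m Om t)
  - (J - Jbar t) *m alpha_d (R t) (Rd t) (Om t) (Omd t) (derive1 Omd t).
have bJde : bounded_on D Jde.
  apply: bounded_onD; last exact: bounded_onN (bounded_onM bP bal).
  apply: bounded_onD; last first.
    exact: bounded_onN (bounded_onM (bounded_on_hat bOm) (bounded_onM bP bOm)).
  apply: bounded_onD; last exact: bounded_onN (bounded_onZ _ be).
  exact: bounded_onN (bounded_onZ _ beR).
have [b hb] := bounded_onM (bounded_on_cst D (invmx J)) bJde.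
exists b => t tD; have [_ t0t _] := Dt t tD.
have := hb t tD; rewrite /Jde hat_mul e_RE.
rewrite -(velocity_error_dynamics loop t0t (ltry _)) mulmxA mulVmx ?mul1mx //.
exact: J_unit.
Qed.

End LyapunovAnalysis.

(** * From the eigenvalues of the inertia matrix to the Lyapunov estimates *)

Lemma posdef_eigenvalue_gt0 (K : realType) (J : 'M[K]_3) (l : K) :
  posdef J -> eigenvalue J l -> 0 < l.
Proof.
move=> Jpos /eigenvalueP[v vJ v0].
have vT0 : v^T != 0 by rewrite trmx_eq0.
have := Jpos _ vT0; rewrite trmxK vJ -scalemxAl mxE.
have : 0 < (v *m v^T) 0 0.
  by have := ip_gt0 vT0; rewrite /ip trmxK /mxtrace big_ord1.
by move=> vv; rewrite pmulr_lgt0.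
Qed.

Theorem proposition4 (K : realType) (J : 'M[K]_3) (lm lM : K)
    (g1 g2 g3 kR kOm kJ c : K)
    (Rd : K -> 'M[K]_3) (Omd : K -> 'cV[K]_3)
    (J_sym : J^T = J) (J_pos : posdef J)
    (J_min : is_min_eigenvalue J lm) (J_max : is_max_eigenvalue J lM)
    (g1_gt0 : 0 < g1) (g2_gt0 : 0 < g2) (g3_gt0 : 0 < g3)
    (g12 : g1 != g2) (g23 : g2 != g3) (g31 : g3 != g1)
    (kR_gt0 : 0 < kR) (kOm_gt0 : 0 < kOm) (kJ_gt0 : 0 < kJ) (c_gt0 : 0 < c)
    (command : attitude_command Rd Omd) :
  let G := diag3 g1 g2 g3 in
  c < Num.min
        (Num.min (Num.sqrt (2 * b1 g1 g2 g3 * kR * lm / lM ^+ 2))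
                 (Num.sqrt 2 * kOm / (lM * \tr G)))
        (4 * kR * kOm / (kOm ^+ 2 + 4 / Num.sqrt 2 * kR * lM * \tr G)) ->
  [/\ zero_errors_stable J kR kOm kJ c G Rd Omd,
      errors_uniformly_bounded J kR kOm kJ c G Rd Omd,
      attitude_error_converges J kR kOm kJ c G Rd Omd &
      bounded_command Omd -> velocity_error_converges J kR kOm kJ c G Rd Omd].

Proof.
move=> G; rewrite !lt_min => /andP[/andP[c_sqrt _] c_third].
have lm_gt0 : 0 < lm by case: J_min => Jl _; apply: posdef_eigenvalue_gt0 Jl.
have lm_lM : lm <= lM by case: J_min => _; apply; case: J_max.
have lM_gt0 : 0 < lM by apply: lt_le_trans lm_lM.
have J_ge (x : 'cV[K]_3) : lm * ip x x <= ip x (J *m x).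
  by case: J_min => _ H; apply: rayleigh_ge_eigenvalue.
have J_le (x : 'cV[K]_3) : ip x (J *m x) <= lM * ip x x.
  by case: J_max => _ H; apply: rayleigh_le_eigenvalue.
have c_pos : c ^+ 2 * lM ^+ 2 < 2 * b1 g1 g2 g3 * kR * lm.
  rewrite -ltr_pdivlMr ?exprn_gt0 //.
  rewrite -[ltRHS]sqr_sqrtr; first by rewrite ltr_pXn2r ?nnegrE ?sqrtr_ge0 ?ltW.
  apply: ltW; rewrite divr_gt0 ?exprn_gt0 //.
  by do 3 apply: mulr_gt0 => //; apply: b1_gt0.
have c_diss : c * (kOm ^+ 2 + 2 * Num.sqrt 2 * kR * lM * \tr G) < 4 * kR * kOm.
  have s0 : 0 < Num.sqrt 2 :> K by rewrite sqrtr_gt0.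
  have ss : Num.sqrt 2 * Num.sqrt 2 = 2 :> K by rewrite -expr2 sqr_sqrtr.
  have tG : 0 < \tr G by rewrite tr_diag3 !addr_gt0.
  have e4 : 4 / Num.sqrt 2 = 2 * Num.sqrt 2 :> K.
    have -> : 4 = 2 * (Num.sqrt 2 * Num.sqrt 2) :> K by rewrite ss; lra.
    by rewrite mulrA mulfK ?gt_eqF.
  move: c_third; rewrite e4 ltr_pdivlMr //.
  by rewrite addr_gt0 ?exprn_gt0 // !mulr_gt0.
split.
- exact: (stable J_sym lm_gt0 lm_lM J_ge J_le).
- exact: (uniformly_bounded J_sym lm_gt0 lm_lM J_ge J_le).
- exact: (attitude_converges J_sym lm_gt0 lm_lM J_ge J_le).
- exact: (velocity_converges J_sym lm_gt0 lm_lM J_ge J_le).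
Qed.
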